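(* Let $\Omega\subset\mathbb{R}^2$ be a convex body (compact convex set with non-empty interior) with piecewise $C^1$ boundary which is axially symmetric, i.e. invariant under the reflection in some line. Then for every $h>0$, $\Omega$ has a unique solid angle center of height $h$.
   Context: $A_\Omega^{(h)}(x)=\int_\Omega \frac{h}{(|y-x|^2+h^2)^{3/2}}\,dy$ for $x\in\mathbb{R}^2$, $h>0$; a solid angle center of height $h$ is a point maximizing $A_\Omega^{(h)}$ over $\mathbb{R}^2$. *)

(* Defs.v *)
From Stdlib Require Import Reals Lra ClassicalEpsilon.
Open Scope R_scope.

Definition pt := (R * R)%type.

Definition dist2 (x y : pt) : R :=
  (fst x - fst y) ^ 2 + (snd x - snd y) ^ 2.

Definition kernel (h : R) (x y : pt) : R :=
  h / (sqrt (dist2 y x + h ^ 2)) ^ 3.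

Definition ind (Om : pt -> Prop) (y : pt) : R :=
  if excluded_middle_informative (Om y) then 1 else 0.

(* Riemann sum of  1_Om * f  over the lattice (1/n)Z^2 restricted to the box
   [-n, n]^2, each lattice point weighted by the cell area 1/n^2. *)
Definition grid_sum (Om : pt -> Prop) (f : pt -> R) (n : nat) : R :=
  sum_f_R0 (fun i =>
    sum_f_R0 (fun j =>
      let y := ((INR i - INR (n * n)) / INR n, (INR j - INR (n * n)) / INR n) in
      ind Om y * f y) (2 * n * n)) (2 * n * n) / (INR n) ^ 2.

Definition integral2 (Om : pt -> Prop) (f : pt -> R) (I : R) : Prop :=
  Un_cv (grid_sum Om f) I.

Definition solid_angle (Om : pt -> Prop) (h : R) (x : pt) (I : R) : Prop :=
  integral2 Om (kernel h x) I.

Definition is_solid_angle_center (Om : pt -> Prop) (h : R) (x : pt) : Prop :=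
  exists I, solid_angle Om h x I /\
    forall y J, solid_angle Om h y J -> J <= I.

Definition convex (Om : pt -> Prop) : Prop :=
  forall x y t, Om x -> Om y -> 0 <= t <= 1 ->
    Om ((1 - t) * fst x + t * fst y, (1 - t) * snd x + t * snd y).

Definition bounded (Om : pt -> Prop) : Prop :=
  exists M, forall x, Om x -> dist2 x (0, 0) <= M.

Definition closed (Om : pt -> Prop) : Prop :=
  forall x, (forall eps, 0 < eps -> exists y, Om y /\ dist2 x y < eps) -> Om x.

Definition nonempty_interior (Om : pt -> Prop) : Prop :=
  exists x r, 0 < r /\ forall y, dist2 x y < r -> Om y.

Definition convex_body (Om : pt -> Prop) : Prop :=
  convex Om /\ bounded Om /\ closed Om /\ nonempty_interior Om.

Definition boundary (Om : pt -> Prop) (x : pt) : Prop :=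
  forall eps, 0 < eps ->
    (exists y, Om y /\ dist2 x y < eps) /\ (exists y, ~ Om y /\ dist2 x y < eps).

Definition C1 (f : R -> R) : Prop :=
  exists f', (forall t, derivable_pt_lim f t (f' t)) /\ continuity f'.

Definition piecewise_C1_boundary (Om : pt -> Prop) : Prop :=
  exists (g1 g2 : R -> R) (k : nat) (t : nat -> R),
    t 0%nat = 0 /\ t k = 1 /\
    (forall i, (i < k)%nat -> t i < t (S i)) /\
    (forall i, (i < k)%nat -> exists p1 p2, C1 p1 /\ C1 p2 /\
        forall s, t i <= s <= t (S i) -> g1 s = p1 s /\ g2 s = p2 s) /\
    g1 0 = g1 1 /\ g2 0 = g2 1 /\
    (forall s s', 0 <= s < 1 -> 0 <= s' < 1 ->
        g1 s = g1 s' -> g2 s = g2 s' -> s = s') /\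
    (forall x, boundary Om x <-> exists s, 0 <= s <= 1 /\ x = (g1 s, g2 s)).

(* Reflection in the line through p with unit direction u. *)
Definition reflect (p u x : pt) : pt :=
  let d := (fst x - fst p) * fst u + (snd x - snd p) * snd u in
  (2 * fst p + 2 * d * fst u - fst x, 2 * snd p + 2 * d * snd u - snd x).

Definition axially_symmetric (Om : pt -> Prop) : Prop :=
  exists p u : pt, fst u ^ 2 + snd u ^ 2 = 1 /\
    forall x, Om x <-> Om (reflect p u x).

(* Main.v *)
From Stdlib Require Import Reals Lra Lia Ranalysis5 ClassicalEpsilon.
From Coquelicot Require Import Coquelicot.
Require Import Defs.
Open Scope R_scope.

(** The kernel is [h] times the power [-3] of [sqrt (|y - x|^2 + h^2)], which is
    strictly convex in [y - x].  By the Borell-Brascamp-Lieb inequality,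
    integrating over two variables turns [-1/3]-concavity into
    [-1]-concavity, so the reciprocal of the solid angle is a convex function of
    [x], for every convex body.  The inequality is obtained one variable at a
    time by monotone transport of mass: first along vertical segments, where the
    integral is elementary, then over the abscissa.  If two points [x0], [x1]
    attain the maximum, the midpoint cannot exceed it, so equality holds
    throughout; then the transport maps are the translation by [x1 - x0], and
    since they preserve the bounded body, [x0 = x1].

    Moving [x] to its nearest point in a box containing the body increases the
    kernel pointwise, so the search for a maximum is confined to the box, where
    continuity gives existence. *)

(** * Monotone transport on an interval *)

(** Only midpoints and, in the last integration, only equal masses are compared. Two maximizers
    share the value [M], so a bound of slice integrals by their harmonic mean suffices there: when
    both total masses are [M], [midpoint_transport] turns it into the lower bound [M] at the
    midpoint. The first integration gives more, the mean of exponent (-1/3) / (1 - 1/3) = -1/2,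
    which is weakened to the harmonic mean before the second. Strictness enters once, through the
    norm of [(s, t, h)] with [h] fixed, and equality is traced back pointwise along the transport
    map.

    The solid angle is a limit of lattice sums, so it must be identified with an iterated integral
    before transport applies; convexity and closedness supply continuous slice ends, hence bounded
    slices and a continuous slice integral. Continuity in the viewpoint instead rests on comparing
    kernels: distances in space are at least [h], so moving the viewpoint by [d] multiplies the
    kernel by at most [(1 + d / h) ^ 3], a bound that passes to sums and limits. *)

Lemma increasing_of_deriv_pos (F f : R -> R) (p q : R) :
  (forall t, derivable_pt_lim F t (f t)) ->
  (forall t, p < t < q -> 0 < f t) ->
  forall x y, p <= x -> x < y -> y <= q -> F x < F y.
Proof.
  intros dF fpos x y px xy yq.
  destruct (MVT_cor2 F f x y xy) as [c [Hc Hc']].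
  { intros; apply dF. }
  assert (0 < f c) by (apply fpos; lra).
  nra.
Qed.

Lemma deriv_continuity_pt (F : R -> R) (t l : R) :
  derivable_pt_lim F t l -> continuity_pt F t.
Proof.
  intros H; apply derivable_continuous_pt; exists l; exact H.
Qed.

(** Positivity is asked only inside the interval because slice integrals may vanish at its ends,
    where a slice can shrink to a point. Hence the inverse is differentiated only at interior
    values. *)
Lemma inverse_derivable (F f : R -> R) (p q : R) :
  p < q ->
  (forall t, derivable_pt_lim F t (f t)) ->
  (forall t, p < t < q -> 0 < f t) ->
  exists g : R -> R,
    (forall v, F p <= v <= F q -> p <= g v <= q /\ F (g v) = v) /\
    (forall v, F p < v < F q ->
       p < g v < q /\ derivable_pt_lim g v (/ f (g v))).
Proof.
  intros pq dF fpos.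
  pose proof (increasing_of_deriv_pos F f p q dF fpos) as Finc.
  assert (Hex : forall v, exists t, F p <= v <= F q -> p <= t <= q /\ F t = v).
  { intros v. destruct (classic (F p <= v <= F q)) as [Hv|Hv].
    - destruct (IVT_cor (fun t => F t - v) p q) as [t [Ht1 Ht2]].
      + intros t. apply (deriv_continuity_pt _ t (f t - 0)).
        apply derivable_pt_lim_minus; [apply dF|apply derivable_pt_lim_const].
      + lra.
      + nra.
      + exists t; intros _; split; lra.
    - exists 0; tauto. }
  pose (g := fun v => proj1_sig (constructive_indefinite_description _ (Hex v))).
  assert (gspec : forall v, F p <= v <= F q -> p <= g v <= q /\ F (g v) = v).
  { intros v. unfold g. destruct constructive_indefinite_description; auto. }
  exists g; split; [exact gspec|].
  intros v Hv.
  assert (gin : p < g v < q).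
  { destruct (gspec v) as [[H1 H2] H3]; [lra|].
    split; apply Rnot_le_lt; intros H.
    - replace (g v) with p in H3 by lra. lra.
    - replace (g v) with q in H3 by lra. lra. }
  split; [exact gin|].
  assert (gp : p <= g (F p)).
  { pose proof (Finc p q); apply gspec; lra. }
  assert (gq : g (F q) <= q).
  { pose proof (Finc p q); apply gspec; lra. }
  assert (ginc : forall u w, F p <= u -> u <= w -> w <= F q -> g u <= g w).
  { intros u w Hu Huw Hw. apply Rnot_lt_le; intros H.
    destruct (gspec u) as [[A1 A2] A3]; [lra|].
    destruct (gspec w) as [[B1 B2] B3]; [lra|].
    pose proof (Finc (g w) (g u)). lra. }
  assert (gcont : continuity_pt g v).
  { apply (continuity_pt_recip_interv F g p q pq); auto.
    - intros x H1 H2. unfold comp, id. apply gspec; lra.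
    - intros x H1 H2. apply gspec; lra.
    - intros a _. apply (deriv_continuity_pt _ _ _ (dF a)). }
  set (Prf := fun (a : R) (_ : g (F p) <= a <= g (F q)) =>
     exist (derivable_pt_abs F a) (f a) (dF a) : derivable_pt F a).
  assert (Hi : g (F p) <= g v <= g (F q)) by (split; apply ginc; lra).
  pose proof (derivable_pt_lim_recip_interv F g (F p) (F q) v Prf gcont
    ltac:(lra) Hv Hi) as D.
  assert (E : derive_pt F (g v) (Prf (g v) Hi) = f (g v)).
  { unfold derive_pt, Prf; reflexivity. }
  rewrite E in D.
  replace (/ f (g v)) with (1 / f (g v)) by (unfold Rdiv; ring).
  apply D.
  - intros x Hx; unfold comp, id; apply gspec; lra.
  - pose proof (fpos (g v) gin). lra.
Qed.

Lemma nondecreasing_of_deriv_nonneg (F f : R -> R) (p q : R) :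
  (forall t, p < t < q -> derivable_pt_lim F t (f t)) ->
  (forall t, p < t < q -> 0 <= f t) ->
  forall x y, p < x -> x <= y -> y < q -> F x <= F y.
Proof.
  intros dF fpos x y px xy yq.
  destruct (Req_dec x y) as [->|ne]; [lra|].
  destruct (MVT_cor2 F f x y) as [c [Hc Hc']]; [lra| |].
  { intros; apply dF; lra. }
  assert (0 <= f c) by (apply fpos; lra).
  nra.
Qed.

(** Carries a bound proved at interior points, where the transport map is controlled, to an end of
    the interval. *)
Lemma le_at_left_limit (F : R -> R) (a q L : R) :
  a < q -> continuity_pt F q -> (forall y, a < y < q -> F y <= L) -> F q <= L.
Proof.
  intros aq cF H. apply Rnot_lt_le; intros Hlt.
  destruct (cF (F q - L)) as [d [dpos Hd]]; [lra|].
  pose (y := Rmax (q - d / 2) ((a + q) / 2)).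
  assert (Hy : a < y < q /\ q - d / 2 <= y).
  { unfold y, Rmax; destruct Rle_dec; lra. }
  specialize (H y ltac:(tauto)).
  assert (Hd' : Rabs (F y - F q) < F q - L).
  { apply (Hd y). split; [split; [exact I|lra]|].
    simpl; unfold Rdist. apply Rabs_def1; lra. }
  apply Rabs_def2 in Hd'. lra.
Qed.

Lemma le_at_right_limit (F : R -> R) (p b L : R) :
  p < b -> continuity_pt F p -> (forall y, p < y < b -> F y <= L) -> F p <= L.
Proof.
  intros pb cF H.
  pose proof (le_at_left_limit (fun t => F (- t)) (- b) (- p) L) as K.
  cbv beta in K. rewrite Ropp_involutive in K. apply K; [lra| |].
  - apply (continuity_pt_comp (fun t => - t) F).
    + apply continuity_pt_opp, derivable_continuous_pt, derivable_pt_id.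
    + rewrite Ropp_involutive; exact cF.
  - intros y Hy; apply H; lra.
Qed.

(* The monotone map [T] sending the normalised mass of [f0] to that of [f1] has
   slope [I1 f0 y / (I0 f1 (T y))], so that along [z y = (y + T y) / 2] the mass
   of [fm] grows at least [C] times as fast as the normalised mass of [f0]. *)
Lemma midpoint_transport (F0 f0 F1 f1 Fm fm : R -> R) (p0 q0 p1 q1 C : R) :
  p0 < q0 -> p1 < q1 ->
  (forall t, derivable_pt_lim F0 t (f0 t)) ->
  (forall t, derivable_pt_lim F1 t (f1 t)) ->
  (forall t, derivable_pt_lim Fm t (fm t)) ->
  (forall t, p0 < t < q0 -> 0 < f0 t) ->
  (forall t, p1 < t < q1 -> 0 < f1 t) ->
  (forall t, (p0 + p1) / 2 < t < (q0 + q1) / 2 -> 0 < fm t) ->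
  let I0 := F0 q0 - F0 p0 in
  let I1 := F1 q1 - F1 p1 in
  (forall y y', p0 < y < q0 -> p1 < y' < q1 ->
     C <= fm ((y + y') / 2) * ((I0 / f0 y + I1 / f1 y') / 2)) ->
  let D := Fm ((q0 + q1) / 2) - Fm ((p0 + p1) / 2) in
  C <= D /\
  (D <= C -> forall y, p0 < y < q0 -> exists y', p1 < y' < q1 /\
     fm ((y + y') / 2) * ((I0 / f0 y + I1 / f1 y') / 2) = C).
Proof.
  intros pq0 pq1 dF0 dF1 dFm f0pos f1pos fmpos I0 I1 HC D.
  pose proof (increasing_of_deriv_pos _ _ _ _ dF0 f0pos) as inc0.
  pose proof (increasing_of_deriv_pos _ _ _ _ dF1 f1pos) as inc1.
  pose proof (increasing_of_deriv_pos _ _ _ _ dFm fmpos) as incm.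
  assert (I0pos : 0 < I0) by (unfold I0; pose proof (inc0 p0 q0); lra).
  assert (I1pos : 0 < I1) by (unfold I1; pose proof (inc1 p1 q1); lra).
  destruct (inverse_derivable F1 f1 p1 q1 pq1 dF1 f1pos) as [g [_ dg]].
  pose (m := fun y => F1 p1 + (I1 / I0) * (F0 y - F0 p0)).
  pose (T := fun y => g (m y)).
  assert (k1 : 0 < I1 / I0) by (apply Rdiv_lt_0_compat; lra).
  assert (mrange : forall y, p0 < y < q0 -> F1 p1 < m y < F1 q1).
  { intros y Hy. pose proof (inc0 p0 y) as H1. pose proof (inc0 y q0) as H2.
    unfold m. split; [nra|].
    assert ((I1 / I0) * (F0 y - F0 p0) < (I1 / I0) * I0).
    { apply Rmult_lt_compat_l; [lra|]. unfold I0. lra. }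
    replace (I1 / I0 * I0) with I1 in H by (field; lra). unfold I1 in *. lra. }
  assert (dm : forall y, derivable_pt_lim m y (I1 / I0 * f0 y)).
  { intros y. unfold m.
    replace (I1 / I0 * f0 y) with (0 + (I1 / I0) * (f0 y - 0)) by ring.
    apply derivable_pt_lim_plus; [apply derivable_pt_lim_const|].
    apply (derivable_pt_lim_scal (fun y => F0 y - F0 p0)).
    apply derivable_pt_lim_minus; [apply dF0|apply derivable_pt_lim_const]. }
  assert (Tin : forall y, p0 < y < q0 -> p1 < T y < q1).
  { intros y Hy; apply dg, mrange, Hy. }
  assert (dT : forall y, p0 < y < q0 ->
     derivable_pt_lim T y (/ f1 (T y) * (I1 / I0 * f0 y))).
  { intros y Hy. apply (derivable_pt_lim_comp m g); [apply dm|].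
    apply dg, mrange, Hy. }
  (* [Psi] is the mass of [fm] up to the transported midpoint minus [C] times the normalised mass of
     [f0]. Its derivative [psi] is the slack in [HC] times the positive factor [f0 y / I0]. *)
  pose (Psi := fun y => Fm ((y + T y) / 2) - C / I0 * F0 y).
  pose (psi := fun y => f0 y / I0 *
    (fm ((y + T y) / 2) * ((I0 / f0 y + I1 / f1 (T y)) / 2) - C)).
  assert (dPsi : forall y, p0 < y < q0 -> derivable_pt_lim Psi y (psi y)).
  { intros y Hy. unfold Psi.
    replace (psi y) with
      (fm ((y + T y) / 2) * ((1 + / f1 (T y) * (I1 / I0 * f0 y)) * / 2)
       - C / I0 * f0 y).
    - apply derivable_pt_lim_minus.
      + apply (derivable_pt_lim_comp (fun y => (y + T y) / 2) Fm); [|apply dFm].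
        apply (derivable_pt_lim_scal_right (fun y => y + T y)).
        apply derivable_pt_lim_plus; [apply derivable_pt_lim_id|apply dT, Hy].
      + apply (derivable_pt_lim_scal F0), dF0.
    - unfold psi. pose proof (f0pos y Hy). pose proof (f1pos _ (Tin y Hy)).
      field. repeat split; lra. }
  assert (psipos : forall y, p0 < y < q0 -> 0 <= psi y).
  { intros y Hy. unfold psi. apply Rmult_le_pos.
    - apply Rlt_le, Rdiv_lt_0_compat; auto.
    - specialize (HC y (T y) Hy (Tin y Hy)). lra. }
  pose proof (nondecreasing_of_deriv_nonneg _ _ _ _ dPsi psipos) as Psiinc.
  assert (cF0 : forall k c t, continuity_pt (fun y => k * F0 y + c) t).
  { intros k c t. apply (deriv_continuity_pt _ t (k * f0 t + 0)).
    apply derivable_pt_lim_plus; [|apply derivable_pt_lim_const].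
    apply (derivable_pt_lim_scal F0), dF0. }
  assert (key0 : forall y0 y1, p0 < y0 -> y0 <= y1 -> y1 < q0 ->
     Psi y1 - Psi y0 <= D - C / I0 * (F0 y1 - F0 y0)).
  { intros y0 y1 H0 H1 H2. unfold Psi, D.
    pose proof (Tin y0 ltac:(lra)). pose proof (Tin y1 ltac:(lra)).
    pose proof (incm ((p0 + p1) / 2) ((y0 + T y0) / 2)).
    pose proof (incm ((y1 + T y1) / 2) ((q0 + q1) / 2)). lra. }
  (* [Psi] is monotone, so widening [[y0, y1]] only increases the left side of [key0]. As the ends
     tend to [p0] and [q0], the subtracted term tends to [C]. *)
  assert (key : forall y0 y1, p0 < y0 -> y0 <= y1 -> y1 < q0 ->
     Psi y1 - Psi y0 <= D - C).
  { intros y0 y1 H0 H1 H2.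
    assert (K1 : forall y0', p0 < y0' < y0 ->
       C / I0 * F0 q0 + (Psi y1 - Psi y0 - D - C / I0 * F0 y0') <= 0).
    { intros y0' H0'.
      apply (le_at_left_limit
        (fun y => C / I0 * F0 y + (Psi y1 - Psi y0 - D - C / I0 * F0 y0')) y1 q0 0);
        [lra|apply cF0|].
      intros y Hy. pose proof (key0 y0' y ltac:(lra) ltac:(lra) ltac:(lra)).
      pose proof (Psiinc y0' y0). pose proof (Psiinc y1 y). lra. }
    assert (K2 : - (C / I0) * F0 p0
       + (C / I0 * F0 q0 + (Psi y1 - Psi y0 - D)) <= 0).
    { apply (le_at_right_limit (fun y => - (C / I0) * F0 y
       + (C / I0 * F0 q0 + (Psi y1 - Psi y0 - D))) p0 y0 0); [lra|apply cF0|].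
      intros y Hy. pose proof (K1 y Hy). lra. }
    assert (C / I0 * (F0 q0 - F0 p0) = C) by (fold I0; field; lra). lra. }
  assert (CD : C <= D).
  { pose proof (key ((p0 + q0) / 2) ((p0 + q0) / 2) ltac:(lra) ltac:(lra) ltac:(lra)).
    lra. }
  split; [exact CD|].
  intros DC y Hy. exists (T y). split; [apply Tin, Hy|].
  (* When [D <= C], [key] leaves [Psi] no room to grow: it is constant, so the slack in [HC]
     vanishes along the transport map. *)
  assert (psi0 : psi y = 0).
  { apply (uniqueness_limite Psi y); [apply dPsi, Hy|].
    intros e epos.
    assert (dpos : 0 < Rmin (y - p0) (q0 - y)) by (apply Rmin_glb_lt; lra).
    exists (mkposreal _ dpos). intros k kne kd. simpl in kd.
    pose proof (Rmin_l (y - p0) (q0 - y)). pose proof (Rmin_r (y - p0) (q0 - y)).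
    apply Rabs_def2 in kd.
    assert (E : Psi (y + k) = Psi y).
    { destruct (Rle_dec 0 k).
      - pose proof (Psiinc y (y + k)). pose proof (key y (y + k)). lra.
      - pose proof (Psiinc (y + k) y). pose proof (key (y + k) y). lra. }
    rewrite E. replace ((Psi y - Psi y) / k - 0) with 0 by (field; auto).
    rewrite Rabs_R0; exact epos. }
  unfold psi in psi0. apply Rmult_integral in psi0.
  pose proof (Rdiv_lt_0_compat _ _ (f0pos y Hy) I0pos).
  destruct psi0; lra.
Qed.

(** * Integrals of the kernel over segments *)

Definition slant (h s t : R) : R := sqrt (s ^ 2 + t ^ 2 + h ^ 2).

(** Substituting t = r tan(u) with r^2 = s^2 + h^2 turns the integral of [h / slant h s t ^ 3] from
    0 into h sin(u) / r^2, which is this formula. *)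
Definition kernel_prim (h s t : R) : R := h * t / ((s ^ 2 + h ^ 2) * slant h s t).

Lemma slant_sqr (h s t : R) : slant h s t ^ 2 = s ^ 2 + t ^ 2 + h ^ 2.
Proof. unfold slant; rewrite pow2_sqrt; nra. Qed.

Lemma slant_pos (h s t : R) : 0 < h -> 0 < slant h s t.
Proof. intros hp; apply sqrt_lt_R0; nra. Qed.

Lemma kernel_prim_deriv (h s t : R) : 0 < h ->
  derivable_pt_lim (kernel_prim h s) t (h / slant h s t ^ 3).
Proof.
  intros hp. apply is_derive_Reals. unfold kernel_prim.
  pose proof (slant_pos h s t hp) as Sp. pose proof (slant_sqr h s t) as Sq.
  unfold slant in *.
  assert (E : s * (s * 1) + t * (t * 1) + h * (h * 1) = s ^ 2 + t ^ 2 + h ^ 2) by ring.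
  assert (E' : s * (s * 1) + h * (h * 1) = sqrt (s ^ 2 + t ^ 2 + h ^ 2) ^ 2 - t ^ 2) by lra.
  assert (P : 0 < sqrt (s ^ 2 + t ^ 2 + h ^ 2) ^ 2 - t ^ 2) by nra.
  auto_derive; rewrite ?E, ?E'; set (r := sqrt _) in *.
  - split; [nra|]. split; [|easy]. apply Rgt_not_eq, Rmult_lt_0_compat; assumption.
  - replace (s ^ 2 + h ^ 2) with (r ^ 2 - t ^ 2) by lra. field. lra.
Qed.

(** [slant] is the Euclidean norm of [(s, t, h)], so this is the triangle inequality. Equality
    forces parallel vectors, and parallel vectors with the same non-zero third coordinate
    coincide. *)
Lemma slant_midpoint (h s0 s1 t0 t1 : R) : 0 < h ->
  let a0 := slant h s0 t0 in
  let a1 := slant h s1 t1 in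
  let am := slant h ((s0 + s1) / 2) ((t0 + t1) / 2) in
  am <= (a0 + a1) / 2 /\ (am = (a0 + a1) / 2 -> s0 = s1 /\ t0 = t1).
Proof.
  intros hp a0 a1 am.
  pose proof (slant_pos h s0 t0 hp) as P0. pose proof (slant_pos h s1 t1 hp) as P1.
  pose proof (slant_pos h ((s0 + s1) / 2) ((t0 + t1) / 2) hp) as Pm.
  pose proof (slant_sqr h s0 t0) as S0. pose proof (slant_sqr h s1 t1) as S1.
  pose proof (slant_sqr h ((s0 + s1) / 2) ((t0 + t1) / 2)) as Sm.
  fold a0 in P0, S0. fold a1 in P1, S1. fold am in Pm, Sm.
  set (d := s0 * s1 + t0 * t1 + h ^ 2).
  (* Lagrange's identity: [d] is the inner product of the two vectors, and the right side is the
     squared norm of their cross product. *)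
  assert (L : (a0 * a1) ^ 2 - d ^ 2
    = (s0 * t1 - s1 * t0) ^ 2 + h ^ 2 * ((s0 - s1) ^ 2 + (t0 - t1) ^ 2)).
  { replace ((a0 * a1) ^ 2) with (a0 ^ 2 * a1 ^ 2) by ring.
    rewrite S0, S1. unfold d. ring. }
  assert (M : 4 * am ^ 2 = (a0 + a1) ^ 2 - 2 * (a0 * a1 - d)).
  { rewrite Sm. replace ((a0 + a1) ^ 2) with (a0 ^ 2 + a1 ^ 2 + 2 * (a0 * a1)) by ring.
    rewrite S0, S1. unfold d. field. }
  assert (N : 0 <= (s0 * t1 - s1 * t0) ^ 2) by apply pow2_ge_0.
  assert (N' : 0 <= (s0 - s1) ^ 2 + (t0 - t1) ^ 2)
    by (apply Rplus_le_le_0_compat; apply pow2_ge_0).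
  assert (hh : 0 < h ^ 2) by (apply pow_lt, hp).
  assert (P : 0 < a0 * a1) by nra.
  assert (dle : d <= a0 * a1).
  { apply Rnot_lt_le; intros H. assert (0 <= (a0 * a1) ^ 2 - d ^ 2)
      by (rewrite L; apply Rplus_le_le_0_compat; [|apply Rmult_le_pos]; lra).
    nra. }
  split.
  - apply Rnot_lt_le; intros H. nra.
  - intros E. rewrite E in M. assert (Ed : d = a0 * a1) by lra.
    rewrite Ed in L.
    assert (Z : h ^ 2 * ((s0 - s1) ^ 2 + (t0 - t1) ^ 2) <= 0) by nra.
    assert (Z' : (s0 - s1) ^ 2 + (t0 - t1) ^ 2 <= 0) by nra.
    pose proof (pow2_ge_0 (s0 - s1)). pose proof (pow2_ge_0 (t0 - t1)).
    split; apply Rminus_diag_uniq, Rsqr_0_uniq; rewrite Rsqr_pow2; lra.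
Qed.

(** [a ^ 3 / g ^ 2] is the perspective of the cube, convex and homogeneous of degree one. The left
    side is its tangent plane along the ray [a = m * g]. *)
Lemma cubic_tangent (a g m : R) : 0 <= a -> 0 < g -> 0 <= m ->
  3 * m ^ 2 * a - 2 * m ^ 3 * g <= a ^ 3 / g ^ 2.
Proof.
  intros Ha Hg Hm. apply (Rmult_le_reg_r (g ^ 2)); [nra|].
  replace (a ^ 3 / g ^ 2 * g ^ 2) with (a ^ 3) by (field; lra).
  enough (0 <= (a - m * g) ^ 2 * (a + 2 * (m * g))) by nra.
  assert (0 <= m * g) by (apply Rmult_le_pos; lra).
  apply Rmult_le_pos; [apply pow2_ge_0|lra].
Qed.

(** Hölder's inequality with exponents 3 and 3/2: the tangent plane for the ratio [m] of the sums
    touches at the sum and lies below each term. *)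
Lemma holder_two (a0 a1 g0 g1 : R) : 0 < a0 -> 0 < a1 -> 0 < g0 -> 0 < g1 ->
  (a0 + a1) ^ 3 / (g0 + g1) ^ 2 <= a0 ^ 3 / g0 ^ 2 + a1 ^ 3 / g1 ^ 2.
Proof.
  intros. pose (m := (a0 + a1) / (g0 + g1)).
  assert (0 < m) by (apply Rdiv_lt_0_compat; lra).
  pose proof (cubic_tangent a0 g0 m). pose proof (cubic_tangent a1 g1 m).
  assert ((a0 + a1) ^ 3 / (g0 + g1) ^ 2
    = (3 * m ^ 2 * a0 - 2 * m ^ 3 * g0) + (3 * m ^ 2 * a1 - 2 * m ^ 3 * g1)).
  { unfold m. field. lra. }
  lra.
Qed.

Lemma kernel_prim_lt (h s p q : R) : 0 < h -> p < q ->
  kernel_prim h s p < kernel_prim h s q.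
Proof.
  intros hp pq.
  apply (increasing_of_deriv_pos _ (fun t => h / slant h s t ^ 3) p q); try lra.
  - intros t; apply kernel_prim_deriv, hp.
  - intros t _. apply Rdiv_lt_0_compat; [lra|]. apply pow_lt, slant_pos, hp.
Qed.

(* The kernel is [h] times the power [-3] of a function convex in [(s, t)], so
   its integral over a segment in [t] is the power [-2] of a convex function. *)
Lemma segment_midpoint (h s0 p0 q0 s1 p1 q1 : R) :
  0 < h -> p0 < q0 -> p1 < q1 ->
  let I0 := kernel_prim h s0 q0 - kernel_prim h s0 p0 in
  let I1 := kernel_prim h s1 q1 - kernel_prim h s1 p1 in
  let D := kernel_prim h ((s0 + s1) / 2) ((q0 + q1) / 2)
           - kernel_prim h ((s0 + s1) / 2) ((p0 + p1) / 2) in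
  1 <= D * ((/ I0 + / I1) / 2) /\
  (D * ((/ I0 + / I1) / 2) <= 1 -> s0 = s1 /\ p1 <= p0 /\ q0 <= q1).
Proof.
  intros hp pq0 pq1 I0 I1 D.
  assert (I0pos : 0 < I0) by (unfold I0; pose proof (kernel_prim_lt h s0 p0 q0 hp pq0); lra).
  assert (I1pos : 0 < I1) by (unfold I1; pose proof (kernel_prim_lt h s1 p1 q1 hp pq1); lra).
  (* The power -1/2 of the integrals, in which the bound becomes an arithmetic mean. *)
  pose (g0 := / sqrt I0). pose (g1 := / sqrt I1).
  assert (g0pos : 0 < g0) by (apply Rinv_0_lt_compat, sqrt_lt_R0, I0pos).
  assert (g1pos : 0 < g1) by (apply Rinv_0_lt_compat, sqrt_lt_R0, I1pos).
  assert (E0 : / I0 = g0 ^ 2).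
  { unfold g0. rewrite pow_inv, pow2_sqrt; lra. }
  assert (E1 : / I1 = g1 ^ 2).
  { unfold g1. rewrite pow_inv, pow2_sqrt; lra. }
  assert (F0 : I0 = / g0 ^ 2) by (rewrite <- E0, Rinv_inv; reflexivity).
  assert (F1 : I1 = / g1 ^ 2) by (rewrite <- E1, Rinv_inv; reflexivity).
  (* The power -2 of the mean of [g0] and [g1]: Hölder followed by [slant_midpoint] yields exactly
     this constant, and [CC] later compares it with the harmonic mean of [I0] and [I1]. *)
  pose (C := 4 / (g0 + g1) ^ 2).
  assert (Cpos : 0 < C) by (apply Rdiv_lt_0_compat; nra).
  assert (chain : forall t0 t1,
    let a0 := slant h s0 t0 in
    let a1 := slant h s1 t1 in
    let am := slant h ((s0 + s1) / 2) ((t0 + t1) / 2) in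
    let X := (a0 ^ 3 / g0 ^ 2 + a1 ^ 3 / g1 ^ 2) in
    h / am ^ 3 * ((I0 / (h / a0 ^ 3) + I1 / (h / a1 ^ 3)) / 2) = X / 2 * / am ^ 3 /\
    C <= X / 2 * / ((a0 + a1) / 2) ^ 3 /\ 0 < X / 2).
  { intros t0 t1 a0 a1 am X.
    assert (P0 : 0 < a0) by (apply slant_pos, hp).
    assert (P1 : 0 < a1) by (apply slant_pos, hp).
    assert (Pm : 0 < am) by (apply slant_pos, hp).
    pose proof (holder_two a0 a1 g0 g1 P0 P1 g0pos g1pos) as H. fold X in H.
    split; [|split].
    - rewrite F0, F1. unfold X. field. repeat split; lra.
    - replace (X / 2 * / ((a0 + a1) / 2) ^ 3) with (4 / (a0 + a1) ^ 3 * X) by (field; lra).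
      replace C with (4 / (a0 + a1) ^ 3 * ((a0 + a1) ^ 3 / (g0 + g1) ^ 2))
        by (unfold C; field; lra).
      apply Rmult_le_compat_l; [|exact H].
      apply Rlt_le, Rdiv_lt_0_compat; [lra|]. apply pow_lt; lra.
    - assert (0 < a0 ^ 3 / g0 ^ 2) by (apply Rdiv_lt_0_compat; apply pow_lt; lra).
      assert (0 < a1 ^ 3 / g1 ^ 2) by (apply Rdiv_lt_0_compat; apply pow_lt; lra).
      unfold X; lra. }
  assert (pos : forall s t, 0 < h / slant h s t ^ 3).
  { intros s t. apply Rdiv_lt_0_compat; [lra|]. apply pow_lt, slant_pos, hp. }
  destruct (midpoint_transport
    (kernel_prim h s0) (fun t => h / slant h s0 t ^ 3)
    (kernel_prim h s1) (fun t => h / slant h s1 t ^ 3)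
    (kernel_prim h ((s0 + s1) / 2)) (fun t => h / slant h ((s0 + s1) / 2) t ^ 3)
    p0 q0 p1 q1 C pq0 pq1) as [CD Heq].
  1-3: intros t; apply kernel_prim_deriv, hp.
  1-3: intros t _; apply pos.
  { intros t0 t1 _ _. fold I0 I1. cbv beta.
    destruct (chain t0 t1) as [Ea [Eb Ec]]. rewrite Ea.
    eapply Rle_trans; [exact Eb|]. apply Rmult_le_compat_l; [lra|].
    apply Rinv_le_contravar; [apply pow_lt, slant_pos, hp|].
    apply pow_incr. split; [apply Rlt_le, slant_pos, hp|].
    apply slant_midpoint, hp. }
  fold D in CD, Heq. fold I0 I1 in Heq.
  rewrite E0, E1.
  assert (CC : 1 <= C * ((g0 ^ 2 + g1 ^ 2) / 2)).
  { apply (Rmult_le_reg_r ((g0 + g1) ^ 2)); [nra|].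
    unfold C. replace (4 / (g0 + g1) ^ 2 * ((g0 ^ 2 + g1 ^ 2) / 2) * (g0 + g1) ^ 2)
      with (2 * (g0 ^ 2 + g1 ^ 2)) by (field; lra).
    pose proof (pow2_ge_0 (g0 - g1)). lra. }
  assert (gp : 0 < (g0 ^ 2 + g1 ^ 2) / 2).
  { pose proof (pow_lt g0 2 g0pos). pose proof (pow_lt g1 2 g1pos). lra. }
  split.
  { eapply Rle_trans; [exact CC|]. apply Rmult_le_compat_r; lra. }
  intros HD.
  assert (DC : D <= C).
  { apply (Rmult_le_reg_r ((g0 ^ 2 + g1 ^ 2) / 2)); lra. }
  (* Equality along the transport map forces equality in [slant_midpoint], so the map fixes every
     interior point [t], which therefore lies in the second segment. *)
  assert (same : forall t, p0 < t < q0 -> s0 = s1 /\ p1 < t < q1).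
  { intros t Ht. destruct (Heq DC t Ht) as [t' [Ht' E]].
    destruct (chain t t') as [Ea [Eb Ec]]. cbv beta in E. rewrite Ea in E.
    destruct (slant_midpoint h s0 s1 t t' hp) as [Ml Me].
    assert (P0 : 0 < slant h s0 t) by (apply slant_pos, hp).
    assert (P1 : 0 < slant h s1 t') by (apply slant_pos, hp).
    assert (Pm : 0 < slant h ((s0 + s1) / 2) ((t + t') / 2)) by (apply slant_pos, hp).
    destruct Me as [-> ->]; [|tauto].
    apply Rle_antisym; [exact Ml|]. apply Rnot_lt_le; intros Hlt.
    assert (/ ((slant h s0 t + slant h s1 t') / 2) ^ 3
       < / slant h ((s0 + s1) / 2) ((t + t') / 2) ^ 3).
    { apply Rinv_lt_contravar; [apply Rmult_lt_0_compat; apply pow_lt; lra|].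
      assert (cube : forall x y, 0 < x -> x < y -> x ^ 3 < y ^ 3).
      { intros x y Hx Hxy. pose proof (Rmult_lt_0_compat x y Hx ltac:(lra)).
        pose proof (pow_lt x 2 Hx). pose proof (pow_lt y 2 ltac:(lra)).
        assert (0 < (y - x) * (y ^ 2 + x * y + x ^ 2))
          by (apply Rmult_lt_0_compat; lra). lra. }
      apply cube; lra. }
    assert (Hs := Rmult_lt_compat_l _ _ _ Ec H). lra. }
  split; [apply (same ((p0 + q0) / 2)); lra|].
  split; apply Rnot_lt_le; intros Hlt.
  - pose proof (same (Rmin ((p0 + p1) / 2) ((p0 + q0) / 2))) as K.
    unfold Rmin in K; destruct Rle_dec in K; lra.
  - pose proof (same (Rmax ((q0 + q1) / 2) ((p0 + q0) / 2))) as K.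
    unfold Rmax in K; destruct Rle_dec in K; lra.
Qed.

(** * Two points with the same solid angle *)

(** The graphs are total so that integrands are continuous on the whole line; outside [[a, c]] they
    do not describe the body. Strictness is required only inside, since an extreme slice may be a
    point. *)
Definition has_slices (Om : pt -> Prop) (a c : R) (lo up : R -> R) : Prop :=
  a < c /\ continuity lo /\ continuity up /\
  (forall y t, Om (y, t) <-> a <= y <= c /\ lo y <= t <= up y) /\
  (forall y, lo y <= up y) /\
  (forall y, a < y < c -> lo y < up y).

Definition slice_angle (h : R) (lo up : R -> R) (x : pt) (y : R) : R :=
  kernel_prim h (y - fst x) (up y - snd x) - kernel_prim h (y - fst x) (lo y - snd x).

Lemma kernel_prim_continuity (h k l : R) (b : R -> R) : 0 < h -> continuity b ->
  continuity (fun y => kernel_prim h (y - k) (b y - l)).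
Proof.
  intros hp cb y. unfold kernel_prim, slant.
  assert (c1 : continuity_pt (fun y => y - k) y).
  { apply (deriv_continuity_pt _ y (1 - 0)), derivable_pt_lim_minus;
      [apply derivable_pt_lim_id|apply derivable_pt_lim_const]. }
  assert (c2 : continuity_pt (fun y => b y - l) y).
  { apply continuity_pt_minus; [apply cb|apply continuity_pt_const; easy]. }
  assert (sqr : forall f, continuity_pt f y -> continuity_pt (fun y => f y ^ 2) y).
  { intros f cf. apply (continuity_pt_comp f (fun t => t ^ 2)); [exact cf|].
    apply (deriv_continuity_pt _ _ _ (derivable_pt_lim_pow _ 2)). }
  assert (cst : forall v, continuity_pt (fun _ : R => v) y).
  { intros v; apply continuity_pt_const; easy. }
  assert (hh : 0 < h ^ 2) by (apply pow_lt, hp).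
  pose proof (pow2_ge_0 (y - k)) as N1. pose proof (pow2_ge_0 (b y - l)) as N2.
  apply continuity_pt_div.
  - apply continuity_pt_mult; auto.
  - apply continuity_pt_mult.
    + apply (continuity_pt_plus (fun y => (y - k) ^ 2)); auto.
    + apply (continuity_pt_comp (fun y => (y - k) ^ 2 + (b y - l) ^ 2 + h ^ 2) sqrt).
      * apply (continuity_pt_plus (fun y => (y - k) ^ 2 + (b y - l) ^ 2)); auto.
        apply (continuity_pt_plus (fun y => (y - k) ^ 2)); auto.
      * apply continuity_pt_sqrt. lra.
  - apply Rgt_not_eq, Rmult_lt_0_compat; [lra|]. apply sqrt_lt_R0; lra.
Qed.

Lemma slice_angle_continuity (h : R) (lo up : R -> R) (x : pt) :
  0 < h -> continuity lo -> continuity up -> continuity (slice_angle h lo up x).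
Proof.
  intros hp clo cup y.
  apply (continuity_pt_minus (fun y => kernel_prim h (y - fst x) (up y - snd x)));
    apply kernel_prim_continuity; assumption.
Qed.

Lemma continuity_RInt_deriv (f : R -> R) (a : R) : continuity f ->
  forall t, derivable_pt_lim (fun y => RInt f a y) t (f t).
Proof.
  intros cf t. apply is_derive_Reals, (is_derive_RInt f (fun y => RInt f a y) a).
  - apply filter_forall. intros y. apply (@RInt_correct R_CompleteNormedModule).
    apply (@ex_RInt_continuous R_CompleteNormedModule). intros z _.
    apply continuity_pt_filterlim, cf.
  - apply continuity_pt_filterlim, cf.
Qed.

Lemma kernel_prim_le (h s p q : R) : 0 < h -> p <= q ->
  kernel_prim h s p <= kernel_prim h s q.
Proof.
  intros hp [pq| ->]; [|lra]. apply Rlt_le, kernel_prim_lt; assumption.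
Qed.

Definition midpoint (x y : pt) : pt := ((fst x + fst y) / 2, (snd x + snd y) / 2).

Lemma slices_midpoint (Om : pt -> Prop) (a c : R) (lo up : R -> R) (y y' : R) :
  convex Om -> has_slices Om a c lo up -> a <= y <= c -> a <= y' <= c ->
  lo ((y + y') / 2) <= (lo y + lo y') / 2 /\
  (up y + up y') / 2 <= up ((y + y') / 2).
Proof.
  intros cv [ac [clo [cup [Hs [Hle Hlt]]]]] Hy Hy'.
  assert (K : forall t t', lo y <= t <= up y -> lo y' <= t' <= up y' ->
    lo ((y + y') / 2) <= (t + t') / 2 <= up ((y + y') / 2)).
  { intros t t' Ht Ht'.
    assert (H : Om ((y + y') / 2, (t + t') / 2)).
    { replace ((y + y') / 2) with ((1 - / 2) * fst (y, t) + / 2 * fst (y', t'))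
        by (simpl; field).
      replace ((t + t') / 2) with ((1 - / 2) * snd (y, t) + / 2 * snd (y', t'))
        by (simpl; field).
      apply cv; [apply Hs; auto|apply Hs; auto|lra]. }
    apply Hs in H. tauto. }
  pose proof (Hle y). pose proof (Hle y').
  split; apply K; lra.
Qed.

(** In coordinates centred at the viewpoint, [x0] and [x1] give two translates of one body, and by
    convexity the means of their points lie in the translate given by the midpoint. The last
    hypothesis puts [midpoint_transport] with [C = M] in its equality case. *)
Lemma body_midpoint (Om : pt -> Prop) (a c : R) (lo up : R -> R) (h M : R) (x0 x1 : pt) :
  convex Om -> has_slices Om a c lo up -> 0 < h ->
  RInt (slice_angle h lo up x0) a c = M ->
  RInt (slice_angle h lo up x1) a c = M ->
  RInt (slice_angle h lo up (midpoint x0 x1)) a c <= M ->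
  x0 = x1.
Proof.
  intros cv HS hp E0 E1 Em.
  assert (HS' := HS). destruct HS' as [ac [clo [cup [Hs [Hle Hlt]]]]].
  set (xm := midpoint x0 x1) in *.
  pose (j := slice_angle h lo up).
  assert (cj : forall x, continuity (j x)) by (intros; apply slice_angle_continuity; auto).
  assert (jpos : forall x y, a < y < c -> 0 < j x y).
  { intros x y Hy. specialize (Hlt y Hy). unfold j, slice_angle.
    pose proof (kernel_prim_lt h (y - fst x) (lo y - snd x) (up y - snd x) hp). lra. }
  assert (Ipt : forall x, RInt (j x) a a = 0) by (intros; rewrite RInt_point; reflexivity).
  assert (I0 : RInt (j x0) a c - RInt (j x0) a a = M) by (rewrite Ipt; unfold j; lra).
  assert (I1 : RInt (j x1) a c - RInt (j x1) a a = M) by (rewrite Ipt; unfold j; lra).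
  assert (Mpos : 0 < M).
  { rewrite <- E0. apply RInt_gt_0; [exact ac|apply jpos|].
    intros t _. apply continuity_pt_filterlim, cj. }
  assert (pw : forall y y', a < y < c -> a < y' < c ->
    1 <= j xm ((y + y') / 2) * ((/ j x0 y + / j x1 y') / 2) /\
    (j xm ((y + y') / 2) * ((/ j x0 y + / j x1 y') / 2) <= 1 ->
      y - fst x0 = y' - fst x1 /\ lo y' - snd x1 <= lo y - snd x0 /\
      up y - snd x0 <= up y' - snd x1)).
  { intros y y' Hy Hy'.
    pose proof (Hlt y Hy) as L0. pose proof (Hlt y' Hy') as L1.
    pose proof (jpos x0 y Hy) as J0. pose proof (jpos x1 y' Hy') as J1.
    destruct (segment_midpoint h (y - fst x0) (lo y - snd x0) (up y - snd x0)
      (y' - fst x1) (lo y' - snd x1) (up y' - snd x1) hp) as [Sl Se]; [lra|lra|].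
    fold (slice_angle h lo up x0 y) in Sl, Se. fold (slice_angle h lo up x1 y') in Sl, Se.
    fold (j x0) in Sl, Se. fold (j x1) in Sl, Se.
    set (D := _ - _) in Sl at 1. set (D' := _ - _) in Se at 1. change D' with D in Se.
    (* The mean of the two segments lies inside the slice over the mean abscissa. *)
    assert (Dle : D <= j xm ((y + y') / 2)).
    { destruct (slices_midpoint Om a c lo up y y' cv HS) as [Ml Mu]; [lra|lra|].
      unfold D, j, slice_angle, xm, midpoint. simpl fst. simpl snd.
      replace ((y + y') / 2 - (fst x0 + fst x1) / 2)
        with ((y - fst x0 + (y' - fst x1)) / 2) by field.
      set (s := (y - fst x0 + (y' - fst x1)) / 2).
      pose proof (kernel_prim_le h s ((up y - snd x0 + (up y' - snd x1)) / 2)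
        (up ((y + y') / 2) - (snd x0 + snd x1) / 2) hp ltac:(lra)).
      pose proof (kernel_prim_le h s (lo ((y + y') / 2) - (snd x0 + snd x1) / 2)
        ((lo y - snd x0 + (lo y' - snd x1)) / 2) hp ltac:(lra)).
      lra. }
    assert (Ipos : 0 <= (/ j x0 y + / j x1 y') / 2).
    { pose proof (Rinv_0_lt_compat _ J0). pose proof (Rinv_0_lt_compat _ J1). lra. }
    pose proof (Rmult_le_compat_r _ _ _ Ipos Dle).
    split; [lra|]. intros H'. apply Se. lra. }
  destruct (midpoint_transport
    (fun y => RInt (j x0) a y) (j x0) (fun y => RInt (j x1) a y) (j x1)
    (fun y => RInt (j xm) a y) (j xm) a c a c M ac ac) as [_ Heq].
  1-3: apply continuity_RInt_deriv, cj.
  1-2: intros t Ht; apply jpos, Ht.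
  { intros t Ht; apply jpos; lra. }
  { intros y y' Hy Hy'. cbv beta. rewrite I0, I1.
    destruct (pw y y' Hy Hy') as [H _].
    replace (j xm ((y + y') / 2) * ((M / j x0 y + M / j x1 y') / 2))
      with (M * (j xm ((y + y') / 2) * ((/ j x0 y + / j x1 y') / 2)))
      by (unfold Rdiv; ring).
    rewrite <- (Rmult_1_r M) at 1. apply Rmult_le_compat_l; lra. }
  cbv beta in Heq. rewrite I0, I1 in Heq.
  replace ((c + c) / 2) with c in Heq by field.
  replace ((a + a) / 2) with a in Heq by field.
  rewrite Ipt, Rminus_0_r in Heq. specialize (Heq Em).
  assert (Heq' : forall y, a < y < c -> exists y', a < y' < c /\
      y - fst x0 = y' - fst x1 /\ lo y' - snd x1 <= lo y - snd x0 /\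
      up y - snd x0 <= up y' - snd x1).
  { intros y Hy. destruct (Heq y Hy) as [y' [Hy' E]].
    exists y'; split; [exact Hy'|]. apply (pw y y' Hy Hy').
    apply (Rmult_le_reg_l M); [exact Mpos|]. rewrite Rmult_1_r.
    rewrite <- E at 2. apply Req_le. unfold Rdiv; ring. }
  (* The shift by [d] would map the open interval [(a, c)] into itself; a point within [|d|] of the
     relevant end contradicts this. *)
  assert (F : fst x0 = fst x1).
  { set (d := fst x1 - fst x0).
    destruct (Rtotal_order d 0) as [H|[H|H]]; [exfalso| unfold d in H; lra|exfalso].
    - destruct (Heq' (Rmin (a - d / 2) ((a + c) / 2))) as [y' [K1 [K2 _]]].
      + unfold Rmin; destruct Rle_dec; lra.
      + unfold Rmin in K2; destruct Rle_dec in K2; unfold d in *; lra.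
    - destruct (Heq' (Rmax (c - d / 2) ((a + c) / 2))) as [y' [K1 [K2 _]]].
      + unfold Rmax; destruct Rle_dec; lra.
      + unfold Rmax in K2; destruct Rle_dec in K2; unfold d in *; lra. }
  (* Now [y'] is the same abscissa, so both segments are shifts of a single slice. One contains the
     other, which pins down the vertical shift. *)
  destruct (Heq' ((a + c) / 2)) as [y' [_ [K1 [K2 K3]]]]; [lra|].
  replace y' with ((a + c) / 2) in * by lra.
  destruct x0, x1; simpl in *. f_equal; lra.
Qed.

(** * Grid sums and iterated integrals *)

Definition node (n k : nat) : R := (INR k - INR (n * n)) / INR n.

Lemma node_succ (n k : nat) : (0 < n)%nat -> node n (S k) = node n k + / INR n.
Proof.
  intros np. apply lt_0_INR in np. unfold node. rewrite S_INR. field. lra.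
Qed.

Lemma node_first (n : nat) : (0 < n)%nat -> node n 0 = - INR n.
Proof.
  intros np. apply lt_0_INR in np. unfold node. rewrite mult_INR. simpl INR. field. lra.
Qed.

Lemma node_last (n : nat) : (0 < n)%nat -> node n (2 * n * n) = INR n.
Proof.
  intros np. apply lt_0_INR in np. unfold node. rewrite !mult_INR. simpl INR. field. lra.
Qed.

(* Only the two cells containing [p] and [q] contribute more than the
   oscillation of [f], at most [2 * B / n] each. *)
Lemma lattice_sum_integral (n : nat) (p q eps B : R) (f F w : R -> R) :
  (0 < n)%nat -> - INR n < p -> p <= q -> q < INR n -> 0 <= eps ->
  (forall t, p <= t <= q -> derivable_pt_lim F t (f t)) ->
  (forall t, p <= t <= q -> Rabs (f t) <= B) ->
  (forall t t', p <= t <= q -> p <= t' <= q -> Rabs (t - t') <= / INR n ->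
     Rabs (f t - f t') <= eps) ->
  (forall t, p <= t <= q -> w t = f t) ->
  (forall t, ~ (p <= t <= q) -> w t = 0) ->
  Rabs (sum_f_R0 (fun k => w (node n k)) (2 * n * n) / INR n - (F q - F p))
    <= eps * (q - p) + 4 * (B * / INR n).
Proof.
  intros np Hp pq Hq epos dF fB feps win wout.
  assert (npos : 0 < INR n) by (apply lt_0_INR, np).
  set (d := / INR n) in *.
  assert (dpos : 0 < d) by (apply Rinv_0_lt_compat, npos).
  assert (Bpos : 0 <= B).
  { eapply Rle_trans; [apply Rabs_pos|apply (fB p); lra]. }
  assert (Bd : 0 <= B * d) by (apply Rmult_le_pos; lra).
  assert (inc : forall u v, p <= u -> u <= v -> v <= q -> v - u <= d ->
     Rabs (F v - F u) <= B * d /\ Rabs (f v * d) <= B * d /\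
     Rabs ((v - u) * f v - (F v - F u)) <= eps * (v - u)).
  { intros u v H1 H2 H3 H4.
    assert (G : Rabs (f v * d) <= B * d).
    { rewrite Rabs_mult, (Rabs_right d) by lra. apply Rmult_le_compat_r; [lra|].
      apply fB; lra. }
    destruct (Req_dec u v) as [<-|ne].
    - rewrite !Rminus_diag, Rabs_R0. replace (0 * f u - 0) with 0 by ring.
      rewrite Rabs_R0. repeat split; lra.
    - destruct (MVT_cor2 F f u v) as [x [Hx Hx']]; [lra| |].
      { intros; apply dF; lra. }
      split; [|split; [exact G|]].
      + rewrite Hx, Rabs_mult, (Rabs_right (v - u)) by lra.
        apply Rmult_le_compat; try lra; [apply Rabs_pos|apply fB; lra].
      + replace ((v - u) * f v - (F v - F u)) with ((f v - f x) * (v - u))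
          by (rewrite Hx; ring).
        rewrite Rabs_mult, (Rabs_right (v - u)) by lra.
        apply Rmult_le_compat_r; [lra|]. apply feps; try lra.
        rewrite Rabs_right; lra. }
  (* [bd t] is the error allowed once the nodes up to [t] are read: the oscillation over the part of
     [[p, q]] already covered, plus [2 * (B * d)] for each end passed. *)
  pose (cl := fun t => Rmax p (Rmin t q)).
  pose (bd := fun t => eps * (cl t - p) + (if Rlt_dec t p then 0 else 2 * (B * d))
     + (if Rlt_dec q t then 2 * (B * d) else 0)).
  assert (clL : forall t, t <= p -> cl t = p).
  { intros; unfold cl. rewrite Rmin_left, Rmax_left; lra. }
  assert (clM : forall t, p <= t <= q -> cl t = t).
  { intros; unfold cl. rewrite Rmin_left, Rmax_right; lra. }
  assert (clR : forall t, q <= t -> cl t = q).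
  { intros; unfold cl. rewrite Rmin_right, Rmax_right; lra. }
  assert (main : forall k,
     Rabs (sum_f_R0 (fun k => w (node n k)) k / INR n - (F (cl (node n k)) - F p))
       <= bd (node n k)).
  { intros k. unfold Rdiv. fold d. induction k as [|k IH].
    - simpl sum_f_R0. rewrite node_first by exact np.
      unfold bd. rewrite clL by lra. rewrite wout by lra.
      replace (0 * d - (F p - F p)) with 0 by ring. rewrite Rabs_R0.
      repeat destruct Rlt_dec; lra.
    - rewrite tech5, node_succ by exact np. fold d.
      set (S := sum_f_R0 _ k) in *. set (t := node n k) in *.
      set (t' := t + d). rewrite Rmult_plus_distr_r.
      unfold bd in *.
      destruct (Rlt_dec t' p) as [A|A].
      { rewrite clL in * by (unfold t' in *; lra).
        rewrite wout by lra. revert IH. unfold t' in *.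
        repeat destruct Rlt_dec; try lra.
        replace (S * d + 0 * d) with (S * d) by ring. auto. }
      destruct (Rlt_dec t p) as [A'|A'].
      { rewrite (clL t) in IH by lra.
        destruct (Rlt_dec q t) as [C|C]; [lra|].
        destruct (Rlt_dec q t') as [D|D].
        (* All of [[p, q]] lies strictly between two nodes: no node samples it, and its integral is
           at most [B * d]. *)
        - rewrite clR by lra. rewrite wout by lra.
          destruct (inc p q) as [I1 _]; [lra|lra|lra|unfold t' in *; lra|].
          revert IH I1. unfold Rabs; repeat destruct Rcase_abs; nra.
        - rewrite clM by lra. rewrite win by lra.
          destruct (inc p t') as [I1 [I2 _]]; [lra|lra|lra|unfold t' in *; lra|].
          assert (0 <= eps * (t' - p)) by (apply Rmult_le_pos; lra).
          revert IH I1 I2. unfold Rabs; repeat destruct Rcase_abs; lra. }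
      destruct (Rlt_dec q t) as [C|C].
      { rewrite clR in * by (unfold t' in *; lra).
        rewrite wout by (unfold t'; lra).
        destruct (Rlt_dec q t'); [|unfold t' in *; lra].
        replace (S * d + 0 * d) with (S * d) by ring. exact IH. }
      rewrite (clM t) in IH by lra.
      destruct (Rlt_dec q t') as [D|D].
      + rewrite clR by lra. rewrite wout by lra.
        destruct (inc t q) as [I1 _]; [lra|lra|lra|unfold t' in *; lra|].
        assert (0 <= eps * (q - t)) by (apply Rmult_le_pos; lra).
        revert IH I1. unfold Rabs; repeat destruct Rcase_abs; lra.
      + rewrite clM by lra. rewrite win by lra.
        destruct (inc t t') as [_ [_ I3]];
          [lra|unfold t'; lra|lra|unfold t'; lra|].
        replace (t' - t) with d in I3 by (unfold t'; ring).
        replace (t' - p) with (t - p + d) by (unfold t'; ring).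
        revert IH I3. unfold Rabs; repeat destruct Rcase_abs; lra. }
  specialize (main (2 * n * n)%nat). rewrite node_last in main by exact np.
  unfold bd in main. rewrite clR in main by lra.
  revert main. repeat destruct Rlt_dec; lra.
Qed.

Lemma slant_triangle (h s t s' t' : R) : 0 < h ->
  slant h s t <= slant h s' t' + (Rabs (s - s') + Rabs (t - t')).
Proof.
  intros hp. set (d := Rabs (s - s') + Rabs (t - t')).
  pose proof (slant_pos h s' t' hp) as P'. pose proof (slant_sqr h s' t') as S'.
  set (a := slant h s' t') in *.
  pose proof (Rabs_pos (s - s')) as N1. pose proof (Rabs_pos (t - t')) as N2.
  assert (A1 : Rabs s' <= a).
  { apply Rsqr_incr_0_var; [|lra]. rewrite <- Rsqr_abs, !Rsqr_pow2, S'.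
    pose proof (pow2_ge_0 t'). pose proof (pow_lt h 2 hp). lra. }
  assert (A2 : Rabs t' <= a).
  { apply Rsqr_incr_0_var; [|lra]. rewrite <- Rsqr_abs, !Rsqr_pow2, S'.
    pose proof (pow2_ge_0 s'). pose proof (pow_lt h 2 hp). lra. }
  assert (M1 : s' * (s - s') <= a * Rabs (s - s')).
  { eapply Rle_trans; [apply Rle_abs|]. rewrite Rabs_mult.
    apply Rmult_le_compat_r; assumption. }
  assert (M2 : t' * (t - t') <= a * Rabs (t - t')).
  { eapply Rle_trans; [apply Rle_abs|]. rewrite Rabs_mult.
    apply Rmult_le_compat_r; assumption. }
  unfold slant. apply Rsqr_incr_0_var; [|unfold d; lra].
  rewrite !Rsqr_pow2, <- (slant_sqr h s t) in *. rewrite pow2_sqrt by apply pow2_ge_0.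
  rewrite slant_sqr.
  pose proof (Rmult_le_pos _ _ N1 N2).
  replace ((a + d) ^ 2) with (a ^ 2 + 2 * (a * d) + d ^ 2) by ring. rewrite S'.
  assert (d ^ 2 = (s - s') ^ 2 + (t - t') ^ 2 + 2 * (Rabs (s - s') * Rabs (t - t'))).
  { unfold d. rewrite <- (pow2_abs (s - s')), <- (pow2_abs (t - t')). ring. }
  unfold d at 1. lra.
Qed.

Lemma slant_ge (h s t : R) : 0 < h -> h <= slant h s t.
Proof.
  intros hp. unfold slant. rewrite <- (sqrt_pow2 h) at 1 by lra.
  apply sqrt_le_1_alt. pose proof (pow2_ge_0 s). pose proof (pow2_ge_0 t). lra.
Qed.

Lemma density_pos (h s t : R) : 0 < h -> 0 < h / slant h s t ^ 3.
Proof. intros hp; apply Rdiv_lt_0_compat; [|apply pow_lt, slant_pos]; exact hp. Qed.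

Lemma density_bound (h s t : R) : 0 < h -> h / slant h s t ^ 3 <= / h ^ 2.
Proof.
  intros hp. replace (/ h ^ 2) with (h / h ^ 3) by (field; lra).
  apply Rmult_le_compat_l; [lra|]. apply Rinv_le_contravar; [apply pow_lt, hp|].
  apply pow_incr. split; [lra|apply slant_ge, hp].
Qed.

(** Because [slant] is at least [h], adding [d] to it multiplies it by at most [1 + d / h]. *)
Lemma density_ratio (h s t s' t' d : R) : 0 < h ->
  Rabs (s - s') + Rabs (t - t') <= d ->
  h / slant h s t ^ 3 <= (1 + d / h) ^ 3 * (h / slant h s' t' ^ 3).
Proof.
  intros hp Hd.
  pose proof (slant_triangle h s' t' s t hp) as T.
  rewrite (Rabs_minus_sym s'), (Rabs_minus_sym t') in T.
  pose proof (slant_pos h s t hp) as P. pose proof (slant_pos h s' t' hp) as P'.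
  pose proof (slant_ge h s t hp) as G.
  assert (d0 : 0 <= d / h).
  { apply Rmult_le_pos; [|apply Rlt_le, Rinv_0_lt_compat, hp].
    pose proof (Rabs_pos (s - s')). pose proof (Rabs_pos (t - t')). lra. }
  assert (K : slant h s' t' <= (1 + d / h) * slant h s t).
  { pose proof (Rmult_le_compat_l _ _ _ d0 G).
    replace (d / h * h) with d in H by (field; lra). lra. }
  set (a := slant h s t) in *. set (a' := slant h s' t') in *.
  replace (h / a ^ 3) with (h * (1 + d / h) ^ 3 * / ((1 + d / h) * a) ^ 3)
    by (field; repeat split; try lra;
        replace (h + d) with (h * (1 + d / h)) by (field; lra);
        apply Rgt_not_eq, Rmult_lt_0_compat; lra).
  replace ((1 + d / h) ^ 3 * (h / a' ^ 3)) with (h * (1 + d / h) ^ 3 * / a' ^ 3)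
    by (unfold Rdiv; ring).
  apply Rmult_le_compat_l.
  - apply Rmult_le_pos; [lra|]. apply pow_le; lra.
  - apply Rinv_le_contravar; [apply pow_lt, P'|]. apply pow_incr; lra.
Qed.

(** The modulus does not depend on [s], so every row of the lattice gets the same error bound. *)
Lemma density_lipschitz (h s t t' d : R) : 0 < h -> Rabs (t - t') <= d ->
  Rabs (h / slant h s t ^ 3 - h / slant h s t' ^ 3) <= ((1 + d / h) ^ 3 - 1) * / h ^ 2.
Proof.
  intros hp Hd.
  assert (d0 : 0 <= d / h).
  { apply Rmult_le_pos; [|apply Rlt_le, Rinv_0_lt_compat, hp].
    pose proof (Rabs_pos (t - t')). lra. }
  assert (c0 : 0 <= (1 + d / h) ^ 3 - 1).
  { pose proof (pow_R1_Rle (1 + d / h) 3). lra. }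
  assert (K : forall u u', Rabs (u - u') <= d ->
    h / slant h s u ^ 3 - h / slant h s u' ^ 3 <= ((1 + d / h) ^ 3 - 1) * / h ^ 2).
  { intros u u' Hu.
    pose proof (density_ratio h s u s u' d hp) as R.
    rewrite Rminus_diag, Rabs_R0 in R. specialize (R ltac:(lra)).
    pose proof (Rmult_le_compat_l _ _ _ c0 (density_bound h s u' hp)). lra. }
  apply Rabs_le. split.
  - pose proof (K t' t). rewrite Rabs_minus_sym in H. lra.
  - apply K, Hd.
Qed.

Lemma kernel_slant (h : R) (x y : pt) :
  kernel h x y = h / slant h (fst y - fst x) (snd y - snd x) ^ 3.
Proof. reflexivity. Qed.

Lemma continuity_bounded (f : R -> R) (a c : R) : a <= c -> continuity f ->
  exists B, forall t, a <= t <= c -> Rabs (f t) <= B.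
Proof.
  intros ac cf.
  destruct (continuity_ab_maj (fun t => Rabs (f t)) a c ac) as [m [Hm _]].
  - intros t _. apply (continuity_pt_comp f Rabs); [apply cf|apply Rcontinuity_abs].
  - exists (Rabs (f m)). exact Hm.
Qed.

Lemma sum_abs_le (u v : nat -> R) (N : nat) :
  (forall k, Rabs (u k) <= v k) -> Rabs (sum_f_R0 u N) <= sum_f_R0 v N.
Proof.
  intros H. eapply Rle_trans; [apply Rsum_abs|]. apply sum_Rle. auto.
Qed.

Lemma grid_sum_rows (Om : pt -> Prop) (f : pt -> R) (n : nat) : (0 < n)%nat ->
  grid_sum Om f n =
  sum_f_R0 (fun i => sum_f_R0 (fun k => ind Om (node n i, node n k)
    * f (node n i, node n k)) (2 * n * n) / INR n) (2 * n * n) / INR n.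
Proof.
  intros np. apply lt_0_INR in np.
  set (r := fun i => sum_f_R0 (fun k => ind Om (node n i, node n k)
    * f (node n i, node n k)) (2 * n * n)).
  change (sum_f_R0 r (2 * n * n) / INR n ^ 2
    = sum_f_R0 (fun i => r i * / INR n) (2 * n * n) / INR n).
  rewrite <- scal_sum. field. lra.
Qed.

Lemma ind_in (Om : pt -> Prop) (y : pt) : Om y -> ind Om y = 1.
Proof. intros H; unfold ind; destruct excluded_middle_informative; tauto. Qed.

Lemma ind_out (Om : pt -> Prop) (y : pt) : ~ Om y -> ind Om y = 0.
Proof. intros H; unfold ind; destruct excluded_middle_informative; tauto. Qed.

(** Fubini by hand: each row is a lattice sum for one slice integral, with an error uniform over
    rows, and the sum over rows is a lattice sum for the continuous function [j]. *)
Lemma solid_angle_slices (Om : pt -> Prop) (a c : R) (lo up : R -> R) (h : R) (x : pt) :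
  has_slices Om a c lo up -> 0 < h ->
  solid_angle Om h x (RInt (slice_angle h lo up x) a c).
Proof.
  intros [ac [clo [cup [Hs [Hle Hlt]]]]] hp.
  set (j := slice_angle h lo up x).
  assert (cj : continuity j) by (apply slice_angle_continuity; assumption).
  destruct (continuity_bounded j a c) as [B HB]; [lra|exact cj|].
  destruct (continuity_bounded lo a c) as [L1 HL1]; [lra|exact clo|].
  destruct (continuity_bounded up a c) as [L2 HL2]; [lra|exact cup|].
  set (L := Rmax L1 L2).
  (* [en d] bounds the error of one row for mesh [d]: kernel oscillation times slice length at most
     [2 * L], plus end cells. In [err], [c - a + 4] bounds the weighted number of rows and
     [4 * (B * d)] covers the end cells of the outer sum; the oscillation of [j] uses the other
     [eps / 2]. *)
  pose (en := fun d => ((1 + d / h) ^ 3 - 1) * / h ^ 2 * (2 * L) + 4 * (/ h ^ 2 * d)).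
  pose (err := fun d => en d * (c - a + 4) + 4 * (B * d)).
  assert (cerr : continuity_pt err 0).
  { apply continuity_pt_filterlim, (ex_derive_continuous err). unfold err, en.
    auto_derive. repeat split; lra. }
  intros eps epos.
  destruct (cerr (eps / 2)) as [d1 [d1pos Hd1]]; [lra|].
  destruct (Heine j (fun t => a <= t <= c) (compact_P3 a c) (fun t _ => cj t)
    (mkposreal (eps / 2 / (c - a)) ltac:(apply Rdiv_lt_0_compat; lra))) as [d2 Hd2].
  simpl in Hd2.
  set (X := Rmax (Rmax (Rabs a) (Rabs c)) (Rmax L (Rmax (/ d1) (Rmax (/ d2) 1)))).
  assert (HX : Rabs a <= X /\ Rabs c <= X /\ L <= X /\ / d1 <= X /\ / d2 <= X /\ 1 <= X).
  { unfold X. repeat split; unfold Rmax; repeat destruct Rle_dec; lra. }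
  destruct (INR_unbounded X) as [N HN].
  exists N. intros n nN. apply le_INR in nN.
  assert (npos : 0 < INR n) by lra.
  assert (np : (0 < n)%nat) by (apply INR_lt; simpl; lra).
  set (d := / INR n).
  assert (dpos : 0 < d) by (apply Rinv_0_lt_compat, npos).
  assert (dd1 : d < d1).
  { rewrite <- (Rinv_inv d1). apply Rinv_lt_contravar; [|lra].
    apply Rmult_lt_0_compat; [apply Rinv_0_lt_compat|]; lra. }
  assert (dd2 : d < d2).
  { pose proof (cond_pos d2). rewrite <- (Rinv_inv d2).
    apply Rinv_lt_contravar; [|lra].
    apply Rmult_lt_0_compat; [apply Rinv_0_lt_compat|]; lra. }
  assert (derr : Rabs (err d) < eps / 2).
  { specialize (Hd1 d). replace (err 0) with 0 in Hd1 by (unfold err, en; field; lra).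
    simpl in Hd1. unfold Rdist in Hd1. rewrite !Rminus_0_r in Hd1. apply Hd1.
    split; [split; [exact I|lra]|]. rewrite Rabs_right; lra. }
  assert (Lbd : forall y, a <= y <= c -> - L <= lo y /\ lo y <= up y /\ up y <= L).
  { intros y Hy. pose proof (HL1 y Hy) as H1. pose proof (HL2 y Hy) as H2.
    pose proof (Rmax_l L1 L2) as M1. pose proof (Rmax_r L1 L2) as M2. fold L in M1, M2.
    apply Rabs_le_between in H1. apply Rabs_le_between in H2. pose proof (Hle y). lra. }
  set (eta := ((1 + d / h) ^ 3 - 1) * / h ^ 2).
  assert (eta0 : 0 <= eta).
  { unfold eta. apply Rmult_le_pos.
    - pose proof (pow_R1_Rle (1 + d / h) 3). pose proof (Rdiv_lt_0_compat d h dpos hp). lra.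
    - apply Rlt_le, Rinv_0_lt_compat, pow_lt, hp. }
  assert (H2p : 0 < / h ^ 2) by (apply Rinv_0_lt_compat, pow_lt, hp).
  pose (row := fun y => sum_f_R0 (fun k => ind Om (y, node n k)
     * kernel h x (y, node n k)) (2 * n * n) / INR n).
  pose (W := fun y => if excluded_middle_informative (a <= y <= c) then j y else 0).
  pose (one := fun y => if excluded_middle_informative (a <= y <= c) then 1 else 0).
  assert (Habs : forall y, Rabs (row y - W y) <= en d * one y).
  { intros y. unfold W, one. destruct excluded_middle_informative as [Hy|Hy].
    - destruct (Lbd y Hy) as [B1 [B2 B3]].
      pose proof (lattice_sum_integral n (lo y) (up y) eta (/ h ^ 2)
        (fun t => h / slant h (y - fst x) (t - snd x) ^ 3)
        (fun t => kernel_prim h (y - fst x) (t - snd x))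
        (fun t => ind Om (y, t) * kernel h x (y, t)) np) as K.
      cbv beta in K. fold d in K. fold (slice_angle h lo up x y) in K.
      fold (row y) in K. fold j in K. eapply Rle_trans; [apply K|].
      + lra.
      + lra.
      + lra.
      + exact eta0.
      + intros t _. rewrite <- (Rmult_1_r (h / _)), <- (Rminus_0_r 1) at 1.
        apply (derivable_pt_lim_comp (fun t => t - snd x) (kernel_prim h (y - fst x))).
        * apply derivable_pt_lim_minus;
            [apply derivable_pt_lim_id|apply derivable_pt_lim_const].
        * apply kernel_prim_deriv, hp.
      + intros t _. rewrite Rabs_right by (apply Rle_ge, Rlt_le, density_pos, hp).
        apply density_bound, hp.
      + intros t t' _ _ Ht. apply density_lipschitz; [exact hp|].
        replace (t - snd x - (t' - snd x)) with (t - t') by ring. exact Ht.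
      + intros t Ht. rewrite ind_in by (apply Hs; auto). rewrite kernel_slant.
        simpl fst; simpl snd. ring.
      + intros t Ht. rewrite ind_out; [ring|]. rewrite Hs. tauto.
      + unfold en. fold eta. rewrite Rmult_1_r.
        apply Rplus_le_compat_r, Rmult_le_compat_l; lra.
    - unfold row. rewrite (sum_eq _ (fun _ => 0)).
      + rewrite sum_cte. replace (0 * _ / _ - 0) with 0 by (unfold Rdiv; ring).
        rewrite Rabs_R0; lra.
      + intros k _. rewrite ind_out; [ring|]. rewrite Hs. tauto. }
  assert (Ha : - INR n < a).
  { destruct HX as [HX _]. apply Rabs_le_between in HX. lra. }
  assert (Hc : c < INR n).
  { destruct HX as [_ [HX _]]. apply Rabs_le_between in HX. lra. }
  (* Counting rows is the lattice sum of the constant 1, with oscillation 0 and bound 1; its error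
     [4 * d] is at most 4. *)
  assert (K1 : sum_f_R0 (fun i => one (node n i)) (2 * n * n) / INR n <= c - a + 4).
  { pose proof (lattice_sum_integral n a c 0 1 (fun _ => 1) id one np Ha) as K.
    unfold id in K. fold d in K.
    assert (d1' : d <= 1).
    { rewrite <- Rinv_1. apply Rinv_le_contravar; lra. }
    assert (K' : Rabs (sum_f_R0 (fun i => one (node n i)) (2 * n * n) / INR n - (c - a))
       <= 0 * (c - a) + 4 * (1 * d)).
    { apply K; unfold one; try lra.
      - intros t _; apply derivable_pt_lim_id.
      - intros; rewrite Rabs_R1; lra.
      - intros; rewrite Rminus_diag, Rabs_R0; lra.
      - intros t Ht; destruct excluded_middle_informative; tauto.
      - intros t Ht; destruct excluded_middle_informative; tauto. }
    apply Rabs_le_between in K'. lra. }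
  assert (K2 : Rabs (sum_f_R0 (fun i => W (node n i)) (2 * n * n) / INR n - RInt j a c)
     <= eps / 2 + 4 * (B * d)).
  { pose proof (lattice_sum_integral n a c (eps / 2 / (c - a)) B j
      (fun y => RInt j a y) W np Ha) as K. cbv beta in K.
    replace (RInt j a c) with (RInt j a c - RInt j a a)
      by (rewrite RInt_point; apply Rminus_0_r).
    replace (eps / 2) with (eps / 2 / (c - a) * (c - a)) by (field; lra).
    fold d in K. apply K; try lra.
    - apply Rlt_le, Rdiv_lt_0_compat; lra.
    - intros t _; apply continuity_RInt_deriv, cj.
    - exact HB.
    - intros t t' Ht Ht' H. apply Rlt_le, Hd2; lra.
    - intros t Ht; unfold W; destruct excluded_middle_informative; tauto.
    - intros t Ht; unfold W; destruct excluded_middle_informative; tauto. }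
  assert (K3 : Rabs (sum_f_R0 (fun i => row (node n i)) (2 * n * n) / INR n
     - sum_f_R0 (fun i => W (node n i)) (2 * n * n) / INR n) <= en d * (c - a + 4)).
  { unfold Rdiv. rewrite <- Rmult_minus_distr_r, <- minus_sum, Rabs_mult.
    fold d. rewrite (Rabs_right d) by lra.
    assert (en0 : 0 <= en d).
    { unfold en. fold eta.
      assert (0 <= L) by (pose proof (Lbd a ltac:(lra)); lra).
      apply Rplus_le_le_0_compat.
      - apply Rmult_le_pos; lra.
      - apply Rmult_le_pos; [lra|]. apply Rmult_le_pos; lra. }
    apply Rle_trans with (en d * (sum_f_R0 (fun i => one (node n i)) (2 * n * n) / INR n)).
    - unfold Rdiv. fold d. rewrite <- Rmult_assoc.
      apply Rmult_le_compat_r; [lra|]. rewrite scal_sum.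
      apply sum_abs_le. intros k. rewrite Rmult_comm. apply Habs.
    - apply Rmult_le_compat_l; assumption. }
  unfold Rdist. rewrite grid_sum_rows by exact np.
  change (Rabs (sum_f_R0 (fun i => row (node n i)) (2 * n * n) / INR n - RInt j a c) < eps).
  unfold err in derr. apply Rabs_def2 in derr.
  apply Rabs_le_between in K2. apply Rabs_le_between in K3. apply Rabs_def1; lra.
Qed.

(** * Convex bodies as regions between two graphs *)

Lemma closed_set_has_max (P : R -> Prop) (K : R) :
  (exists y, P y) -> (forall y, P y -> Rabs y <= K) ->
  (forall c, (forall eps, 0 < eps -> exists y, P y /\ Rabs (y - c) < eps) -> P c) ->
  exists c, P c /\ forall y, P y -> y <= c.
Proof.
  intros ne bd cl.
  destruct (completeness P) as [c [Hub Hlub]]; [|exact ne|].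
  { exists K. intros y Hy. specialize (bd y Hy). apply Rabs_le_between in bd. lra. }
  exists c. split; [|exact Hub].
  apply cl. intros eps epos. apply NNPP. intros H.
  assert (c <= c - eps); [|lra].
  apply Hlub. intros y Hy. apply Rnot_lt_le. intros Hlt. apply H. exists y.
  split; [exact Hy|]. pose proof (Hub y Hy). apply Rabs_def1; lra.
Qed.

Lemma closed_set_has_min (P : R -> Prop) (K : R) :
  (exists y, P y) -> (forall y, P y -> Rabs y <= K) ->
  (forall c, (forall eps, 0 < eps -> exists y, P y /\ Rabs (y - c) < eps) -> P c) ->
  exists a, P a /\ forall y, P y -> a <= y.
Proof.
  intros [y0 Hy0] bd cl.
  destruct (closed_set_has_max (fun y => P (- y)) K) as [c [Hc Hmax]].
  - exists (- y0). rewrite Ropp_involutive. exact Hy0.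
  - intros y Hy. rewrite <- Rabs_Ropp. apply bd, Hy.
  - intros c H. apply cl. intros eps epos. destruct (H eps epos) as [y [Hy Hd]].
    exists (- y). split; [exact Hy|]. rewrite <- Rabs_Ropp.
    replace (- (- y - - c)) with (y - c) by ring. exact Hd.
  - exists (- c). split; [exact Hc|]. intros y Hy.
    specialize (Hmax (- y)). rewrite Ropp_involutive in Hmax. specialize (Hmax Hy). lra.
Qed.

Lemma bounded_coordinates (Om : pt -> Prop) : bounded Om ->
  exists K, forall y t, Om (y, t) -> Rabs y <= K /\ Rabs t <= K.
Proof.
  intros [M HM]. exists (M + 1). intros y t H. specialize (HM _ H).
  unfold dist2 in HM. simpl fst in HM. simpl snd in HM. rewrite !Rminus_0_r in HM.
  pose proof (pow2_ge_0 y). pose proof (pow2_ge_0 t).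
  assert (E : forall z, z ^ 2 <= M -> Rabs z <= M + 1).
  { intros z Hz. rewrite <- pow2_abs in Hz. pose proof (Rabs_pos z).
    apply Rnot_lt_le; intros Hlt. nra. }
  split; apply E; lra.
Qed.

(** [dist2] is a squared distance, and a number below 1 in absolute value has a square no larger
    than that absolute value; hence the radius [Rmin 1 (e / 2)]. *)
Lemma dist2_lt (y t y' t' e : R) : 0 < e ->
  Rabs (y - y') < Rmin 1 (e / 2) -> Rabs (t - t') < Rmin 1 (e / 2) ->
  dist2 (y, t) (y', t') < e.
Proof.
  intros epos.
  assert (K : forall z, Rabs z < Rmin 1 (e / 2) -> z ^ 2 < e / 2).
  { intros z Hz. pose proof (Rmin_l 1 (e / 2)). pose proof (Rmin_r 1 (e / 2)).
    rewrite <- pow2_abs. pose proof (Rabs_pos z). nra. }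
  intros H1 H2. apply K in H1. apply K in H2. unfold dist2; simpl fst; simpl snd. lra.
Qed.

(** Abscissas converge to [c] by choice, so Bolzano-Weierstrass is needed only for the ordinates;
    closedness of the body then gives the limit point. *)
Lemma projection_closed (Om : pt -> Prop) (c : R) : bounded Om -> closed Om ->
  (forall eps, 0 < eps -> exists y, (exists t, Om (y, t)) /\ Rabs (y - c) < eps) ->
  exists t, Om (c, t).
Proof.
  intros bd cl H.
  destruct (bounded_coordinates Om bd) as [K HK].
  assert (Hn : forall n : nat, exists z : pt,
    Om z /\ Rabs (fst z - c) < / (INR n + 1)).
  { intros n. destruct (H (/ (INR n + 1))) as [y [[t Ht] Hy]].
    - apply Rinv_0_lt_compat. pose proof (pos_INR n). lra.
    - exists (y, t). auto. }
  pose (z := fun n => proj1_sig (constructive_indefinite_description _ (Hn n))).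
  assert (Hz : forall n, Om (z n) /\ Rabs (fst (z n) - c) < / (INR n + 1)).
  { intros n. unfold z. destruct constructive_indefinite_description; auto. }
  destruct (Bolzano_Weierstrass (fun n => snd (z n)) (fun t => - K <= t <= K)) as [l Hl].
  - apply compact_P3.
  - intros n. destruct (Hz n) as [H1 _]. destruct (z n) as [y t].
    apply HK in H1. apply Rabs_le_between. tauto.
  - exists l. apply cl. intros eps epos.
    assert (mpos : 0 < Rmin 1 (eps / 2)) by (apply Rmin_glb_lt; lra).
    destruct (INR_unbounded (/ Rmin 1 (eps / 2))) as [N HN].
    destruct (Hl (disc l (mkposreal _ mpos)) N) as [p [Np Hp]].
    { exists (mkposreal _ mpos). intros x Hx. exact Hx. }
    exists (z p). destruct (Hz p) as [H1 H2]. split; [exact H1|].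
    destruct (z p) as [y t]. unfold disc in Hp. simpl in Hp, H2.
    apply dist2_lt; [exact epos| |].
    + rewrite Rabs_minus_sym. eapply Rlt_trans; [exact H2|].
      rewrite <- (Rinv_inv (Rmin 1 (eps / 2))). apply le_INR in Np.
      pose proof (Rinv_0_lt_compat _ mpos).
      apply Rinv_lt_contravar; [apply Rmult_lt_0_compat|]; lra.
    + rewrite Rabs_minus_sym. exact Hp.
Qed.

(** Each [y] lies between [y0] and one end [e], at a fraction [l] of the way. Concavity bounds the
    drop of [u] by [l * (u y0 - u e)], which is small with [l], even when [y0] is itself an end. *)
Lemma concave_lower_semicontinuous (u : R -> R) (a c y0 eps : R) :
  (forall y y' l, a <= y <= c -> a <= y' <= c -> 0 <= l <= 1 ->
     (1 - l) * u y + l * u y' <= u ((1 - l) * y + l * y')) ->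
  a <= y0 <= c -> 0 < eps ->
  exists d, 0 < d /\ forall y, a <= y <= c -> Rabs (y - y0) < d -> u y0 - eps < u y.
Proof.
  intros cc Hy0 epos.
  assert (side : forall e, a <= e <= c -> exists d, 0 < d /\
    forall y l, 0 <= l <= 1 -> y = (1 - l) * y0 + l * e -> Rabs (y - y0) < d ->
    u y0 - eps < u y).
  { intros e He. destruct (Req_dec e y0) as [->|ne].
    - exists 1. split; [lra|]. intros y l Hl -> _.
      replace ((1 - l) * y0 + l * y0) with y0 by ring. lra.
    - set (D := Rabs (u y0 - u e) + 1).
      assert (Dpos : 0 < D) by (unfold D; pose proof (Rabs_pos (u y0 - u e)); lra).
      assert (epos' : 0 < Rabs (e - y0)) by (apply Rabs_pos_lt; lra).
      exists (eps * Rabs (e - y0) / D). split.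
      { apply Rdiv_lt_0_compat; [apply Rmult_lt_0_compat|]; assumption. }
      intros y l Hl -> Hd.
      replace ((1 - l) * y0 + l * e - y0) with (l * (e - y0)) in Hd by ring.
      rewrite Rabs_mult, (Rabs_right l) in Hd by lra.
      assert (lD : l * D < eps).
      { apply (Rmult_lt_reg_r (Rabs (e - y0) / D)); [apply Rdiv_lt_0_compat; lra|].
        replace (l * D * (Rabs (e - y0) / D)) with (l * Rabs (e - y0)) by (field; lra).
        replace (eps * (Rabs (e - y0) / D)) with (eps * Rabs (e - y0) / D)
          by (field; lra). exact Hd. }
      pose proof (cc y0 e l Hy0 He Hl).
      assert (l * (u y0 - u e) <= l * D).
      { apply Rmult_le_compat_l; [lra|]. unfold D.
        pose proof (Rle_abs (u y0 - u e)). lra. }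
      lra. }
  destruct (side a) as [d1 [d1pos H1]]; [lra|].
  destruct (side c) as [d2 [d2pos H2]]; [lra|].
  exists (Rmin d1 d2). split; [apply Rmin_glb_lt; assumption|].
  intros y Hy Hd. pose proof (Rmin_l d1 d2). pose proof (Rmin_r d1 d2).
  destruct (Rtotal_order y y0) as [L|[->|L]]; [|lra|].
  - apply (H1 y ((y0 - y) / (y0 - a))); [|field; lra|lra].
    split; [apply Rmult_le_pos; [lra|]; apply Rlt_le, Rinv_0_lt_compat; lra|].
    apply (Rmult_le_reg_r (y0 - a)); [lra|].
    replace ((y0 - y) / (y0 - a) * (y0 - a)) with (y0 - y) by (field; lra). lra.
  - apply (H2 y ((y - y0) / (c - y0))); [|field; lra|lra].
    split; [apply Rmult_le_pos; [lra|]; apply Rlt_le, Rinv_0_lt_compat; lra|].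
    apply (Rmult_le_reg_r (c - y0)); [lra|].
    replace ((y - y0) / (c - y0) * (c - y0)) with (y - y0) by (field; lra). lra.
Qed.

Lemma slices_concave (Om : pt -> Prop) (a c : R) (lo up : R -> R) :
  convex Om ->
  (forall y t, Om (y, t) <-> a <= y <= c /\ lo y <= t <= up y) ->
  (forall y, a <= y <= c -> lo y <= up y) ->
  forall y y' l, a <= y <= c -> a <= y' <= c -> 0 <= l <= 1 ->
    (1 - l) * up y + l * up y' <= up ((1 - l) * y + l * y') /\
    lo ((1 - l) * y + l * y') <= (1 - l) * lo y + l * lo y'.
Proof.
  intros cv Hs Hle y y' l Hy Hy' Hl.
  pose proof (Hle y Hy). pose proof (Hle y' Hy').
  assert (K : forall t t', Om (y, t) -> Om (y', t') ->
    lo ((1 - l) * y + l * y') <= (1 - l) * t + l * t' <= up ((1 - l) * y + l * y')).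
  { intros t t' Ht Ht'.
    pose proof (cv _ _ _ Ht Ht' Hl) as C. simpl in C. apply Hs in C. tauto. }
  split; apply K; apply Hs; split; lra.
Qed.

(* Concavity gives lower semicontinuity of the upper boundary, closedness of the
   body gives upper semicontinuity. *)
Lemma upper_boundary_continuous (Om : pt -> Prop) (a c : R) (lo up : R -> R) :
  convex Om -> closed Om ->
  (forall y t, Om (y, t) <-> a <= y <= c /\ lo y <= t <= up y) ->
  (forall y, a <= y <= c -> lo y <= up y) ->
  forall y0 eps, a <= y0 <= c -> 0 < eps ->
  exists d, 0 < d /\
    forall y, a <= y <= c -> Rabs (y - y0) < d -> Rabs (up y - up y0) < eps.
Proof.
  intros cv cl Hs Hle y0 eps Hy0 epos.
  pose proof (slices_concave Om a c lo up cv Hs Hle) as cc.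
  destruct (concave_lower_semicontinuous up a c y0 eps) as [d1 [d1pos Hd1]];
    [intros; apply cc; assumption|exact Hy0|exact epos|].
  destruct (concave_lower_semicontinuous (fun y => - lo y) a c y0 (eps / 2))
    as [d2 [d2pos Hd2]]; [|exact Hy0|lra|].
  { intros y y' l Hy Hy' Hl. destruct (cc y y' l Hy Hy' Hl). lra. }
  (* Otherwise points of the body at height [up y0 + eps / 2] occur arbitrarily close to [y0]: there
     [up] is too high, and semicontinuity keeps [lo] below that height. Closedness would put the
     limit, above [up y0], in the body. *)
  assert (usc : exists d, 0 < d /\
    forall y, a <= y <= c -> Rabs (y - y0) < d -> up y < up y0 + eps).
  { apply NNPP. intros N.
    assert (Hin : Om (y0, up y0 + eps / 2)).
    { apply cl. intros e e0.
      assert (mpos : 0 < Rmin 1 (e / 2)) by (apply Rmin_glb_lt; lra).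
      apply NNPP. intros N'. apply N.
      exists (Rmin d2 (Rmin 1 (e / 2))). split; [apply Rmin_glb_lt; assumption|].
      intros y Hy Hyd. apply Rnot_le_lt. intros Hup. apply N'.
      pose proof (Rmin_l d2 (Rmin 1 (e / 2))). pose proof (Rmin_r d2 (Rmin 1 (e / 2))).
      exists (y, up y0 + eps / 2). split.
      - apply Hs. specialize (Hd2 y Hy ltac:(lra)). specialize (Hle y0 Hy0). lra.
      - apply dist2_lt; [exact e0| |].
        + rewrite Rabs_minus_sym. lra.
        + rewrite Rminus_diag, Rabs_R0. exact mpos. }
    apply Hs in Hin. lra. }
  destruct usc as [d3 [d3pos Hd3]].
  exists (Rmin d1 d3). split; [apply Rmin_glb_lt; assumption|].
  intros y Hy Hd. pose proof (Rmin_l d1 d3). pose proof (Rmin_r d1 d3).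
  specialize (Hd1 y Hy ltac:(lra)). specialize (Hd3 y Hy ltac:(lra)).
  apply Rabs_def1; lra.
Qed.

Definition clamp (a c y : R) : R := Rmax a (Rmin y c).

Lemma clamp_in (a c y : R) : a <= c -> a <= clamp a c y <= c.
Proof. intros; unfold clamp, Rmax, Rmin; repeat destruct Rle_dec; lra. Qed.

Lemma clamp_id (a c y : R) : a <= y <= c -> clamp a c y = y.
Proof. intros; unfold clamp, Rmax, Rmin; repeat destruct Rle_dec; lra. Qed.

Lemma clamp_contracts (a c y y' : R) : a <= c ->
  Rabs (clamp a c y - clamp a c y') <= Rabs (y - y').
Proof.
  intros ac. unfold Rabs, clamp, Rmax, Rmin.
  destruct (Rcase_abs (y - y')); repeat destruct Rle_dec; destruct Rcase_abs; lra.
Qed.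

(** [clamp] is a 1-Lipschitz retraction onto [[a, c]], so the constant extension beyond the ends
    inherits relative continuity. *)
Lemma clamp_extension_continuity (f : R -> R) (a c : R) : a <= c ->
  (forall y0 eps, a <= y0 <= c -> 0 < eps -> exists d, 0 < d /\
    forall y, a <= y <= c -> Rabs (y - y0) < d -> Rabs (f y - f y0) < eps) ->
  continuity (fun y => f (clamp a c y)).
Proof.
  intros ac H y0 eps epos.
  destruct (H (clamp a c y0) eps) as [d [dpos Hd]]; [apply clamp_in, ac|exact epos|].
  exists d. split; [exact dpos|]. intros y [_ Hy]. simpl in *. unfold Rdist in *.
  apply Hd; [apply clamp_in, ac|].
  eapply Rle_lt_trans; [apply clamp_contracts, ac|exact Hy].
Qed.

Lemma convex_body_slices (Om : pt -> Prop) : convex_body Om ->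
  exists a c lo up, has_slices Om a c lo up.
Proof.
  intros [cv [bd [cl [[x1 x2] [r [rpos Hr]]]]]].
  destruct (bounded_coordinates Om bd) as [K HK].
  pose (P := fun y => exists t, Om (y, t)).
  (* Half the radius allowed by [dist2_lt], so that a closed square of half-width [dl] fits in the
     body. *)
  pose (dl := Rmin 1 (r / 2) / 2).
  assert (mpos : 0 < Rmin 1 (r / 2)) by (apply Rmin_glb_lt; lra).
  assert (dlpos : 0 < dl) by (unfold dl; lra).
  assert (ball : forall y t, Rabs (y - x1) <= dl -> Rabs (t - x2) <= dl -> Om (y, t)).
  { intros y t H1 H2. rewrite Rabs_minus_sym in H1, H2.
    apply Hr, dist2_lt; unfold dl in *; lra. }
  assert (Dl : Rabs dl = dl) by (apply Rabs_right; lra).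
  assert (ne : exists y, P y).
  { exists x1, x2. apply ball; rewrite Rminus_diag, Rabs_R0; lra. }
  assert (bP : forall y, P y -> Rabs y <= K).
  { intros y [t Ht]. apply HK in Ht. tauto. }
  assert (cP : forall c,
    (forall eps, 0 < eps -> exists y, P y /\ Rabs (y - c) < eps) -> P c).
  { intros c H. apply projection_closed; assumption. }
  destruct (closed_set_has_max P K ne bP cP) as [c [Pc Hc]].
  destruct (closed_set_has_min P K ne bP cP) as [a [Pa Ha]].
  assert (R1 : P (x1 + dl)).
  { exists x2. apply ball; [replace (x1 + dl - x1) with dl by ring|
      rewrite Rminus_diag, Rabs_R0]; lra. }
  assert (R2 : P (x1 - dl)).
  { exists x2. apply ball; [replace (x1 - dl - x1) with (- dl) by ring; rewrite Rabs_Ropp|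
      rewrite Rminus_diag, Rabs_R0]; lra. }
  pose proof (Hc _ R1) as C1. pose proof (Ha _ R2) as A1.
  assert (seg : forall y, a <= y <= c -> P y).
  { intros y Hy. destruct Pa as [ta Hta]. destruct Pc as [tc Htc].
    pose (l := (y - a) / (c - a)).
    exists ((1 - l) * ta + l * tc).
    replace y with ((1 - l) * fst (a, ta) + l * fst (c, tc))
      by (unfold l; simpl; field; lra).
    apply (cv _ _ l Hta Htc). unfold l. split.
    - apply Rmult_le_pos; [lra|]. apply Rlt_le, Rinv_0_lt_compat; lra.
    - apply (Rmult_le_reg_r (c - a)); [lra|].
      replace ((y - a) / (c - a) * (c - a)) with (y - a) by (field; lra). lra. }
  assert (bS : forall y t, Om (y, t) -> Rabs t <= K) by (intros y t H; apply HK in H; tauto).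
  assert (cS : forall y t0,
    (forall eps, 0 < eps -> exists t, Om (y, t) /\ Rabs (t - t0) < eps) -> Om (y, t0)).
  { intros y t0 H. apply cl. intros e e0.
    assert (mpos' : 0 < Rmin 1 (e / 2)) by (apply Rmin_glb_lt; lra).
    destruct (H _ mpos') as [t [Ht Hd]]. exists (y, t). split; [exact Ht|].
    apply dist2_lt; [exact e0| |rewrite Rabs_minus_sym; exact Hd].
    rewrite Rminus_diag, Rabs_R0; exact mpos'. }
  assert (Hup : forall y, exists v, a <= y <= c -> Om (y, v) /\ forall t, Om (y, t) -> t <= v).
  { intros y. destruct (classic (a <= y <= c)) as [Hy|Hy]; [|exists 0; tauto].
    destruct (closed_set_has_max (fun t => Om (y, t)) K) as [v Hv];
      [apply seg, Hy|apply bS|apply cS|]. exists v; auto. }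
  assert (Hlo : forall y, exists v, a <= y <= c -> Om (y, v) /\ forall t, Om (y, t) -> v <= t).
  { intros y. destruct (classic (a <= y <= c)) as [Hy|Hy]; [|exists 0; tauto].
    destruct (closed_set_has_min (fun t => Om (y, t)) K) as [v Hv];
      [apply seg, Hy|apply bS|apply cS|]. exists v; auto. }
  pose (up := fun y => proj1_sig (constructive_indefinite_description _ (Hup y))).
  pose (lo := fun y => proj1_sig (constructive_indefinite_description _ (Hlo y))).
  assert (Eup : forall y, a <= y <= c -> Om (y, up y) /\ forall t, Om (y, t) -> t <= up y).
  { intros y. unfold up. destruct constructive_indefinite_description; auto. }
  assert (Elo : forall y, a <= y <= c -> Om (y, lo y) /\ forall t, Om (y, t) -> lo y <= t).
  { intros y. unfold lo. destruct constructive_indefinite_description; auto. }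
  assert (Hle : forall y, a <= y <= c -> lo y <= up y).
  { intros y Hy. apply (Eup y Hy), Elo, Hy. }
  assert (Hs : forall y t, Om (y, t) <-> a <= y <= c /\ lo y <= t <= up y).
  { intros y t. split.
    - intros H. assert (Hy : a <= y <= c) by (split; [apply Ha|apply Hc]; exists t; exact H).
      split; [exact Hy|]. split; [apply (Elo y Hy), H|apply (Eup y Hy), H].
    - intros [Hy Ht]. destruct (Eup y Hy) as [U _]. destruct (Elo y Hy) as [L _].
      destruct (Req_dec (lo y) (up y)) as [E|ne'].
      { replace t with (up y) by lra. exact U. }
      pose (l := (t - lo y) / (up y - lo y)).
      replace y with ((1 - l) * fst (y, lo y) + l * fst (y, up y)) at 1 by (simpl; ring).
      replace t with ((1 - l) * snd (y, lo y) + l * snd (y, up y))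
        by (unfold l; simpl; field; lra).
      apply (cv _ _ l L U). unfold l. split.
      + apply Rmult_le_pos; [lra|]. apply Rlt_le, Rinv_0_lt_compat; lra.
      + apply (Rmult_le_reg_r (up y - lo y)); [lra|].
        replace ((t - lo y) / (up y - lo y) * (up y - lo y)) with (t - lo y)
          by (field; lra). lra. }
  exists a, c, (fun y => lo (clamp a c y)), (fun y => up (clamp a c y)).
  split; [lra|]. split; [|split; [|split; [|split]]].
  - apply clamp_extension_continuity; [lra|]. intros y0 eps Hy0 epos.
    (* Reflection in the horizontal axis exchanges the two graphs, up to sign. *)
    destruct (upper_boundary_continuous (fun x => Om (fst x, - snd x)) a c
      (fun y => - up y) (fun y => - lo y)) with (y0 := y0) (eps := eps)
      as [d [dpos Hd]]; auto.
    + intros x y t Hx Hy Ht. simpl.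
      replace (- ((1 - t) * snd x + t * snd y)) with ((1 - t) * - snd x + t * - snd y)
        by ring.
      apply (cv _ _ t Hx Hy Ht).
    + intros x H. simpl. apply cl. intros e e0. destruct (H e e0) as [y [Hy Hd]].
      exists (fst y, - snd y). split; [exact Hy|]. revert Hd. unfold dist2. simpl fst; simpl snd.
      replace ((- snd x - - snd y) ^ 2) with ((snd x - snd y) ^ 2) by ring. auto.
    + intros y t. simpl. rewrite Hs. split; intros; lra.
    + intros y Hy. pose proof (Hle y Hy). lra.
    + exists d. split; [exact dpos|]. intros y Hy Hyd.
      rewrite <- Rabs_Ropp. replace (- (lo y - lo y0)) with (- lo y - - lo y0) by ring.
      apply Hd; assumption.
  - apply clamp_extension_continuity; [lra|].
    apply (upper_boundary_continuous Om a c lo up); assumption.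
  - intros y t. rewrite Hs. split.
    + intros [Hy Ht]. rewrite (clamp_id a c y Hy). auto.
    + intros [Hy Ht]. rewrite (clamp_id a c y Hy) in Ht. auto.
  - intros y. apply Hle, clamp_in; lra.
  - intros y Hy. rewrite (clamp_id a c y) by lra.
    assert (W : lo x1 < up x1).
    { assert (T1 : Om (x1, x2 + dl)).
      { apply ball; [rewrite Rminus_diag, Rabs_R0|
          replace (x2 + dl - x2) with dl by ring]; lra. }
      assert (T2 : Om (x1, x2)).
      { apply ball; rewrite Rminus_diag, Rabs_R0; lra. }
      apply Hs in T1. apply Hs in T2. lra. }
    (* Slice length is concave, non-negative at [e] and positive at [x1], the abscissa of the
       interior disc, so it is positive on the way from [e] to [x1]. *)
    assert (side : forall e, a <= e <= c -> forall l, 0 < l <= 1 ->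
      y = (1 - l) * e + l * x1 -> lo y < up y).
    { intros e He l Hl E.
      destruct (slices_concave Om a c lo up cv Hs Hle e x1 l) as [G1 G2];
        [exact He|lra|lra|]. rewrite <- E in G1, G2.
      assert (0 <= (1 - l) * (up e - lo e)).
      { apply Rmult_le_pos; [lra|]. pose proof (Hle e He). lra. }
      assert (0 < l * (up x1 - lo x1)) by (apply Rmult_lt_0_compat; lra). lra. }
    destruct (Rle_dec y x1).
    + apply (side a) with (l := (y - a) / (x1 - a)); [lra| |field; lra].
      split; [apply Rdiv_lt_0_compat; lra|].
      apply (Rmult_le_reg_r (x1 - a)); [lra|].
      replace ((y - a) / (x1 - a) * (x1 - a)) with (y - a) by (field; lra). lra.
    + apply (side c) with (l := (c - y) / (c - x1)); [lra| |field; lra].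
      split; [apply Rdiv_lt_0_compat; lra|].
      apply (Rmult_le_reg_r (c - x1)); [lra|].
      replace ((c - y) / (c - x1) * (c - x1)) with (c - y) by (field; lra). lra.
Qed.

(** * Existence of a maximum *)

Lemma grid_sum_le (Om : pt -> Prop) (f g : pt -> R) (k : R) (n : nat) :
  (forall y, Om y -> f y <= k * g y) -> grid_sum Om f n <= k * grid_sum Om g n.
Proof.
  intros H. unfold grid_sum, Rdiv. rewrite <- Rmult_assoc. apply Rmult_le_compat_r.
  - rewrite <- pow_inv. apply pow_le. destruct n.
    (* At [n = 0] the weight is 0 by the convention [/ 0 = 0]. *)
    + simpl INR. rewrite Rinv_0. lra.
    + apply Rlt_le, Rinv_0_lt_compat, lt_0_INR. lia.
  - rewrite scal_sum. apply sum_Rle. intros i _. cbv beta zeta.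
    rewrite (Rmult_comm _ k), scal_sum.
    apply sum_Rle. intros j _. cbv beta. set (y := (_, _)).
    unfold ind. destruct excluded_middle_informative as [Hy|Hy]; [|lra].
    specialize (H y Hy). lra.
Qed.

(** The factor [k] serves three ends: [k = 1] for moving into the box, [k = 2] for non-negativity,
    and the ratio of [density_ratio] for continuity. *)
Lemma solid_angle_le (Om : pt -> Prop) (h k I J : R) (x y : pt) :
  (forall z, Om z -> kernel h x z <= k * kernel h y z) ->
  solid_angle Om h x I -> solid_angle Om h y J -> I <= k * J.
Proof.
  intros H HI HJ.
  apply (Rle_cv_lim (fun n => grid_sum_le Om (kernel h x) (kernel h y) k n H) HI).
  apply (CV_mult (fun _ => k) _ k J); [|exact HJ].
  intros eps epos. exists 0%nat. intros n _. unfold Rdist.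
  rewrite Rminus_diag, Rabs_R0. exact epos.
Qed.

Lemma cubic_ratio_continuity (h : R) (f : R -> R) : 0 < h ->
  (forall t, 0 <= f t) ->
  (forall t t', f t <= (1 + Rabs (t - t') / h) ^ 3 * f t') -> continuity f.
Proof.
  intros hp f0 Hf t0 eps epos.
  (* With [q] the ratio at distance [e], a rise is at most [(q - 1) * f t0], and a fall at most
     [(q - 1) * f t], hence [(q - 1) * q * f t0]; [g] bounds both. *)
  pose (g := fun d => ((1 + d / h) ^ 3 - 1) * (1 + d / h) ^ 3 * f t0).
  assert (cg : continuity_pt g 0).
  { apply continuity_pt_filterlim, (ex_derive_continuous g). unfold g.
    auto_derive. repeat split; lra. }
  destruct (cg eps epos) as [d [dpos Hd]].
  exists d. split; [exact dpos|]. intros t [_ Ht].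
  change (Rabs (t - t0) < d) in Ht. change (Rabs (f t - f t0) < eps).
  change (forall x, D_x no_cond 0 x /\ Rabs (x - 0) < d -> Rabs (g x - g 0) < eps) in Hd.
  replace (g 0) with 0 in Hd by (unfold g; field; lra).
  set (e := Rabs (t - t0)) in *.
  assert (e0 : 0 <= e) by apply Rabs_pos.
  assert (eh : 0 <= e / h).
  { apply Rmult_le_pos; [exact e0|]. apply Rlt_le, Rinv_0_lt_compat, hp. }
  assert (ge : Rabs (g e) < eps).
  { destruct (Req_dec e 0) as [->|ne].
    - replace (g 0) with 0 by (unfold g; field; lra). rewrite Rabs_R0. exact epos.
    - rewrite <- (Rminus_0_r (g e)). apply Hd. split; [split; [exact I|auto]|].
      rewrite Rminus_0_r, Rabs_right; lra. }
  pose proof (Hf t t0) as H1. pose proof (Hf t0 t) as H2.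
  rewrite Rabs_minus_sym in H2. fold e in H1, H2. unfold g in ge.
  set (q := (1 + e / h) ^ 3) in *.
  assert (q1 : 1 <= q) by (apply pow_R1_Rle; lra).
  pose proof (f0 t0) as F0. apply Rabs_def2 in ge.
  assert (K1 : (q - 1) * f t0 <= (q - 1) * q * f t0).
  { apply Rmult_le_compat_r; [exact F0|]. rewrite <- (Rmult_1_r (q - 1)) at 1.
    apply Rmult_le_compat_l; lra. }
  assert (K2 : (q - 1) * f t <= (q - 1) * (q * f t0)).
  { apply Rmult_le_compat_l; [lra|]. exact H1. }
  apply Rabs_def1; lra.
Qed.

(** Maximizing one coordinate at a time reduces to intervals. The partial maximum inherits the ratio
    bound by comparing [(u, b u)] with [(u', b u)] and then with [(u', b u')]; the selection [b]
    itself need not be continuous. *)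
Lemma maximum_on_box (h : R) (F : pt -> R) (a c K : R) : 0 < h -> a <= c -> 0 <= K ->
  (forall x, 0 <= F x) ->
  (forall x y, F x <= (1 + (Rabs (fst x - fst y) + Rabs (snd x - snd y)) / h) ^ 3 * F y) ->
  exists x, forall y, a <= fst y <= c -> - K <= snd y <= K -> F y <= F x.
Proof.
  intros hp ac K0 F0 HF.
  assert (Hm : forall x1, exists x2, - K <= x2 <= K /\
     forall t, - K <= t <= K -> F (x1, t) <= F (x1, x2)).
  { intros x1. destruct (continuity_ab_maj (fun t => F (x1, t)) (- K) K) as [x2 [H H']].
    - lra.
    - intros t _. apply (cubic_ratio_continuity h (fun t => F (x1, t)) hp).
      + intros; apply F0.
      + intros u u'. pose proof (HF (x1, u) (x1, u')) as H. simpl in H.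
        rewrite Rminus_diag, Rabs_R0, Rplus_0_l in H. exact H.
    - exists x2. split; [exact H'|exact H]. }
  pose (b := fun x1 => proj1_sig (constructive_indefinite_description _ (Hm x1))).
  assert (Hb : forall x1, - K <= b x1 <= K /\
     forall t, - K <= t <= K -> F (x1, t) <= F (x1, b x1)).
  { intros x1. unfold b. destruct constructive_indefinite_description; auto. }
  destruct (continuity_ab_maj (fun x1 => F (x1, b x1)) a c ac) as [x1 [H _]].
  - intros u0 _. apply (cubic_ratio_continuity h (fun x1 => F (x1, b x1)) hp).
    + intros; apply F0.
    + intros u u'. pose proof (HF (u, b u) (u', b u)) as H. simpl in H.
      rewrite Rminus_diag, Rabs_R0, Rplus_0_r in H.
      eapply Rle_trans; [exact H|]. apply Rmult_le_compat_l.
      * apply pow_le.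
        assert (0 <= Rabs (u - u') / h).
        { apply Rmult_le_pos; [apply Rabs_pos|]. apply Rlt_le, Rinv_0_lt_compat, hp. }
        lra.
      * apply Hb, Hb.
  - exists (x1, b x1). intros [y1 y2] H1 H2. simpl in H1, H2.
    eapply Rle_trans; [apply Hb, H2|]. apply H, H1.
Qed.

Lemma clamp_closer (a c y z : R) : a <= z <= c ->
  (z - clamp a c y) ^ 2 <= (z - y) ^ 2.
Proof.
  intros Hz. rewrite <- (pow2_abs (z - y)), <- (pow2_abs (z - clamp a c y)).
  apply pow_incr. split; [apply Rabs_pos|].
  rewrite <- (clamp_id a c z Hz) at 1. apply clamp_contracts; lra.
Qed.

Lemma kernel_clamp_le (h a c K : R) (x z : pt) : 0 < h ->
  a <= fst z <= c -> - K <= snd z <= K ->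
  kernel h x z <= kernel h (clamp a c (fst x), clamp (- K) K (snd x)) z.
Proof.
  intros hp H1 H2. rewrite !kernel_slant. simpl fst; simpl snd.
  apply Rmult_le_compat_l; [lra|].
  apply Rinv_le_contravar; [apply pow_lt, slant_pos, hp|].
  apply pow_incr. split; [apply Rlt_le, slant_pos, hp|].
  apply sqrt_le_1_alt.
  pose proof (clamp_closer a c (fst x) (fst z) H1).
  pose proof (clamp_closer (- K) K (snd x) (snd z) H2). lra.
Qed.

Theorem theorem4p8 (Om : pt -> Prop) :
  convex_body Om -> piecewise_C1_boundary Om -> axially_symmetric Om ->
  forall h : R, 0 < h -> exists! x : pt, is_solid_angle_center Om h x.
Proof.
  intros body _ _ h hp.
  destruct (convex_body_slices Om body) as [a [c [lo [up HS]]]].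
  destruct body as [cv [bd _]].
  destruct (bounded_coordinates Om bd) as [K HK].
  assert (HS' := HS). destruct HS' as [ac [_ [_ [Hs [Hle _]]]]].
  pose (A := fun x => RInt (slice_angle h lo up x) a c).
  assert (HA : forall x, solid_angle Om h x (A x)).
  { intros x. apply solid_angle_slices; assumption. }
  assert (box : forall z, Om z -> a <= fst z <= c /\ - K <= snd z <= K).
  { intros [y t] Hz. split; [apply Hs in Hz; tauto|].
    apply Rabs_le_between. apply HK in Hz. tauto. }
  assert (Kpos : 0 <= K).
  { destruct (box (a, lo a)); [|lra]. apply Hs. pose proof (Hle a). lra. }
  assert (Ale : forall k x y,
    (forall z, Om z -> kernel h x z <= k * kernel h y z) -> A x <= k * A y).
  { intros k x y H. apply (solid_angle_le Om h k _ _ x y H); apply HA. }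
  assert (kpos : forall x z, 0 < kernel h x z).
  { intros x z. rewrite kernel_slant. apply density_pos, hp. }
  (* A positive kernel is at most twice itself, and comparison gives the same for its integral. *)
  assert (A0 : forall x, 0 <= A x).
  { intros x. assert (A x <= 2 * A x); [|lra].
    apply Ale. intros z _. pose proof (kpos x z). lra. }
  destruct (maximum_on_box h A a c K hp) as [x Hx]; [lra|exact Kpos|exact A0| |].
  { intros x y. apply Ale. intros z _. rewrite !kernel_slant.
    apply density_ratio; [exact hp|].
    rewrite (Rabs_minus_sym (fst x)), (Rabs_minus_sym (snd x)). apply Req_le.
    f_equal; f_equal; ring. }
  assert (Hmax : forall y, A y <= A x).
  { intros y. apply Rle_trans with (A (clamp a c (fst y), clamp (- K) K (snd y))).
    - rewrite <- Rmult_1_l. apply Ale. intros z Hz. rewrite Rmult_1_l.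
      apply kernel_clamp_le; [exact hp| |]; apply box, Hz.
    - apply Hx; apply clamp_in; lra. }
  exists x. split.
  - exists (A x). split; [apply HA|]. intros y J HJ.
    rewrite (UL_sequence _ _ _ HJ (HA y)). apply Hmax.
  - intros x' [I' [HI' Hmax']].
    assert (E : A x' = A x).
    { apply Rle_antisym; [apply Hmax|].
      rewrite (UL_sequence _ _ _ (HA x') HI'). apply (Hmax' x), HA. }
    (* Maximality of [x], applied at the midpoint of [x] and [x'], supplies the remaining upper
       bound. *)
    apply (body_midpoint Om a c lo up h (A x) x x' cv HS hp); [reflexivity|exact E|].
    apply Hmax.
Qed.
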